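(* Let $q$ be a power of $3$, let $L$ be a generic line of $PG(3,q)$, let $\mathcal{P}$ be the set of the $q+1$ points of $L$, and let $r=\jmath(f_L)$. (1) If $f_L\in\mathcal{F}_i$ with $i\in\{1,2,4\}$, then $|\mathcal{P}\cap\mathcal{C}|=|\mathcal{P}\cap\mathcal{AX}|=0$, $|\mathcal{P}\cap\mathcal{T}|=i$, $|\mathcal{P}\cap\mathcal{RC}|=\frac{\#\mathcal{E}_r(\mathbb{F}_q)-i}{2}$, and $|\mathcal{P}\cap\mathcal{IC}|=q+1-\frac{\#\mathcal{E}_r(\mathbb{F}_q)+i}{2}$. (2) If $f_L\in\mathcal{F}_2'\cup\mathcal{F}_4'$, then $|\mathcal{P}\cap\mathcal{C}|=|\mathcal{P}\cap\mathcal{AX}|=|\mathcal{P}\cap\mathcal{T}|=0$, $|\mathcal{P}\cap\mathcal{RC}|=\frac{\#\mathcal{E}_r(\mathbb{F}_q)}{2}$, and $|\mathcal{P}\cap\mathcal{IC}|=q+1-\frac{\#\mathcal{E}_r(\mathbb{F}_q)}{2}$.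
   Context: Points of $PG(3,q)$ are $(y_0:y_1:y_2:y_3)$; $\nu(s,t)=(s^3:s^2t:st^2:t^3)$ and the twisted cubic $C$ (also denoted $\mathcal{C}$ as a point set) is $\{\nu(s,t):(s:t)\in PG(1,q)\}$, $C(K)$ the analogous set over $K\supseteq\mathbb{F}_q$. The osculating plane at $\nu(s,t)$ is $t^3y_0-s^3y_3=0$; the axis is the line $y_0=y_3=0$ and $\mathcal{AX}$ is its set of $q+1$ points. The tangent line of $C$ at $\nu(s,t)$ is the line through $\nu(s,t)$ and $(0:s:-t:0)$. $\mathcal{T}$ is the set of points of $PG(3,q)$ lying on a tangent line at a point of $C$ but not in $\mathcal{C}\cup\mathcal{AX}$; $\mathcal{RC}$ is the set of points not in $\mathcal{C}$ lying on a real chord (line joining two distinct points of $C$); $\mathcal{IC}$ is the set of points of $PG(3,q)$ lying on an imaginary chord (line joining two points $P\ne P^q$ of $C(\mathbb{F}_{q^2})$ that are conjugate under Frobenius). A line is generic if it does not meet $C(\overline{\mathbb{F}_q})$ and is not contained in any osculating plane. For the line $L$ through distinct points $x,y$, $p_{ij}=x_iy_j-x_jy_i$ and $f_L=p_{23}X^4+p_{13}X^3Y+p_{03}X^2Y^2+p_{02}XY^3+p_{01}Y^4$. For $f=\sum z_iX^{4-i}Y^i$: $\Delta(f)=(z_0z_4-z_1z_3)^3+(z_0z_4-z_1z_3)^2z_2^2-z_2^3(z_0z_3^2+z_4z_1^2-z_0z_2z_4)$, $\jmath(f)=z_2^6/\Delta(f)$. Types: $\mathcal{F}_4$ (four linear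 factors over $\mathbb{F}_q$), $\mathcal{F}_2$ (two linear, one irreducible quadratic), $\mathcal{F}_1$ (one linear, one irreducible cubic), $\mathcal{F}_4'$ (two irreducible quadratics), $\mathcal{F}_2'$ (irreducible). $\mathcal{E}_r$: $x^2=y^3+y^2-r^{-1}$, $\#\mathcal{E}_r(\mathbb{F}_q)$ counts projective $\mathbb{F}_q$-points including the point at infinity. *)

(* Defs.v *)
From HB Require Import structures.
From mathcomp Require Import all_boot all_order all_algebra.
From mathcomp Require Import mpoly.

Set Implicit Arguments.
Unset Strict Implicit.
Unset Printing Implicit Defensive.

Import GRing.Theory.
Local Open Scope ring_scope.

(* A point (y_0 : y_1 : y_2 : y_3) of PG(3, K) is the vector line <<y>>%MS with
   y != 0, in mathcomp's canonical square-matrix form, so that two points are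
   equal iff their matrices are; incidence is (_ <= _)%MS. The coordinate y_i
   is y 0 i, where i is a numeral of 'I_4 (= Z/4). *)

Definition nu (K : fieldType) (s t : K) : 'rV[K]_4 :=
  \row_(i < 4) (s ^+ (3 - i) * t ^+ i).

Definition proj_points (K : finFieldType) : {set 'M[K]_4} :=
  [set <<y>>%MS | y : 'rV[K]_4 & y != 0].

Definition twisted_cubic (K : finFieldType) : {set 'M[K]_4} :=
  [set <<nu st.1 st.2>>%MS | st : K * K & st != (0, 0)].

Definition axis_points (K : finFieldType) : {set 'M[K]_4} :=
  [set <<y>>%MS | y : 'rV[K]_4 & [&& y != 0, y 0 0 == 0 & y 0 3 == 0]].

Definition in_osculating_plane (K : fieldType) (s t : K) (y : 'rV[K]_4) : bool :=
  t ^+ 3 * y 0 0 - s ^+ 3 * y 0 3 == 0.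

(* The vector (0, s, -t, 0). *)
Definition tangent_dir (K : fieldType) (s t : K) : 'rV[K]_4 :=
  s *: delta_mx 0 1 - t *: delta_mx 0 2.

Definition tangent_line (K : fieldType) (s t : K) : 'M[K]_4 :=
  (nu s t + tangent_dir s t)%MS.

Definition tangent_points (K : finFieldType) : {set 'M[K]_4} :=
  [set P in proj_points K |
     [exists st : K * K, (st != (0, 0)) && (P <= tangent_line st.1 st.2)%MS]]
  :\: (twisted_cubic K :|: axis_points K).

Definition real_chord_points (K : finFieldType) : {set 'M[K]_4} :=
  [set P in proj_points K |
     [exists Q in twisted_cubic K, exists R in twisted_cubic K,
        (Q != R) && (P <= Q + R)%MS]]
  :\: twisted_cubic K.

Definition frob_conj (q : nat) (K : fieldType) (Q : 'M[K]_4) : 'M[K]_4 :=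
  <<map_mx (fun a => a ^+ q) Q>>%MS.

(* Meant for j the embedding of K = F_q into K2 = F_{q^2}. *)
Definition imaginary_chord_points (K K2 : finFieldType) (j : {rmorphism K -> K2}) :
    {set 'M[K]_4} :=
  [set P in proj_points K |
     [exists Q in twisted_cubic K2,
        (Q != frob_conj #|K| Q) &&
        (map_mx j P <= Q + frob_conj #|K| Q)%MS]].

Definition is_line (K : fieldType) (L : 'M[K]_4) : bool := \rank L == 2%N.

Definition line_points (K : finFieldType) (L : 'M[K]_4) : {set 'M[K]_4} :=
  [set P in proj_points K | (P <= L)%MS].

(* Meant for iota the embedding of K into an algebraic closure Kbar. *)
Definition generic_line (K Kbar : fieldType) (iota : {rmorphism K -> Kbar})
    (L : 'M[K]_4) : Prop :=
  (forall s t : Kbar, (s, t) != (0, 0) -> ~~ (nu s t <= map_mx iota L)%MS) /\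
  (forall s t : K, (s, t) != (0, 0) ->
     exists2 y : 'rV[K]_4, (y <= L)%MS & ~~ in_osculating_plane s t y).

Definition plucker (K : fieldType) (x y : 'rV[K]_4) (i j : 'I_4) : K :=
  x 0 i * y 0 j - x 0 j * y 0 i.

(* A binary quartic is given by its coefficients (z_0, ..., z_4). *)
Definition quartic_of_line (K : fieldType) (x y : 'rV[K]_4) : 5.-tuple K :=
  [tuple plucker x y 2 3; plucker x y 1 3; plucker x y 0 3;
         plucker x y 0 2; plucker x y 0 1].

Definition quartic_form (K : fieldType) (z : 5.-tuple K) : {mpoly K[2]} :=
  \sum_(i < 5) z`_i *: ('X_ord0 ^+ (4 - i) * 'X_ord_max ^+ i).

Definition quartic_Delta (K : fieldType) (z : 5.-tuple K) : K :=
  (z`_0 * z`_4 - z`_1 * z`_3) ^+ 3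
  + (z`_0 * z`_4 - z`_1 * z`_3) ^+ 2 * z`_2 ^+ 2
  - z`_2 ^+ 3 * (z`_0 * z`_3 ^+ 2 + z`_4 * z`_1 ^+ 2 - z`_0 * z`_2 * z`_4).

Definition quartic_j (K : fieldType) (z : 5.-tuple K) : K :=
  z`_2 ^+ 6 / quartic_Delta z.

Definition linear_form (K : fieldType) (f : {mpoly K[2]}) : Prop :=
  f != 0 /\ f \is 1.-homog.

Definition irreducible_form (K : fieldType) (d : nat) (f : {mpoly K[2]}) : Prop :=
  [/\ f != 0, f \is d.-homog, f \isn't a GRing.unit &
      forall g h : {mpoly K[2]}, f = g * h ->
        g \is a GRing.unit \/ h \is a GRing.unit].

Definition typeF4 (K : fieldType) (f : {mpoly K[2]}) : Prop :=
  exists a b c d : {mpoly K[2]},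
    [/\ linear_form a, linear_form b, linear_form c, linear_form d
      & f = a * b * c * d].

Definition typeF2 (K : fieldType) (f : {mpoly K[2]}) : Prop :=
  exists a b g : {mpoly K[2]},
    [/\ linear_form a, linear_form b, irreducible_form 2 g & f = a * b * g].

Definition typeF1 (K : fieldType) (f : {mpoly K[2]}) : Prop :=
  exists a g : {mpoly K[2]},
    [/\ linear_form a, irreducible_form 3 g & f = a * g].

Definition typeF4' (K : fieldType) (f : {mpoly K[2]}) : Prop :=
  exists g h : {mpoly K[2]},
    [/\ irreducible_form 2 g, irreducible_form 2 h & f = g * h].

Definition typeF2' (K : fieldType) (f : {mpoly K[2]}) : Prop :=
  irreducible_form 4 f.

(* The affine points of x^2 = y^3 + y^2 - r^-1, plus the point at infinity. *)
Definition card_E (K : finFieldType) (r : K) : nat :=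
  #|[set u : K * K | u.1 ^+ 2 == u.2 ^+ 3 + u.2 ^+ 2 - r^-1]|.+1.

(* Main.v *)
Require Import Defs.
From HB Require Import structures.
From mathcomp Require Import all_boot all_order all_algebra all_field.
From mathcomp Require Import mpoly ring.

(* Normalizing the middle coefficient of f_L to 1, the line L consists of the
   points (U : aU + bV : cU + dV : V). View a point y as a binary cubic. The
   discriminant D of its Hessian vanishes iff y lies on a tangent, is a nonzero
   square iff y lies on a real chord, and a nonsquare iff y lies on an imaginary
   chord; moreover D = f_L(s, t)^3 at U = s^3, V = t^3. Everything thus reduces
   to the zeros of f_L and to the sum of the quadratic characters of its values.
   That sum equals the one for the resolvent cubic, which is a translate of
   y^3 + y^2 - 1/r: if f_L has a rational root, move it to infinity; if f_L takes
   a nonzero square value w^2, move the corresponding point to infinity and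
   parametrize the curve Z^2 = f_L by parabolas Z = w s^2 + p s + u; and if all
   the values were nonsquares, the second case applied to a nonsquare multiple of
   f_L would give a sum of q characters equal to q + 1. *)

Set Implicit Arguments.
Unset Strict Implicit.
Unset Printing Implicit Defensive.

Import GRing.Theory Num.Theory.
Local Open Scope ring_scope.

(** * Arithmetic in characteristic 3 *)

Lemma mul3_eq0 (K : fieldType) (h3 : 3%:R = 0 :> K) :
  ((6%:R = 0 :> K) * (9%:R = 0 :> K) * (12%:R = 0 :> K) * (15%:R = 0 :> K)
     * (18%:R = 0 :> K)) *
  ((- 3%:R = 0 :> K) * (- 6%:R = 0 :> K) * (- 9%:R = 0 :> K)
     * (- 12%:R = 0 :> K) * (- 15%:R = 0 :> K) * (- 18%:R = 0 :> K)).
Proof.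
have E k : (3 * k)%:R = 0 :> K by rewrite natrM h3 mul0r.
by rewrite h3 (E 2%N) (E 3%N) (E 4%N) (E 5%N) (E 6%N) oppr0.
Qed.

(* [ring: h] only replaces monomials whose coefficient is literally the left
   side of [h], hence the list of small multiples of 3. *)
Ltac ring3 h :=
  apply/eqP; rewrite -subr_eq0; apply/eqP;
  case: (mul3_eq0 h) => [[[[[? ?] ?] ?] ?] [[[[[? ?] ?] ?] ?] ?]];
  match goal with
  | p6 : 6%:R = 0, p9 : 9%:R = 0, p12 : 12%:R = 0, p15 : 15%:R = 0,
    p18 : 18%:R = 0, m3 : - 3%:R = 0, m6 : - 6%:R = 0, m9 : - 9%:R = 0,
    m12 : - 12%:R = 0, m15 : - 15%:R = 0, m18 : - 18%:R = 0 |- _ =>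
    ring: h p6 p9 p12 p15 p18 m3 m6 m9 m12 m15 m18
  end.

Lemma char3_natr2 (K : fieldType) (h3 : 3%:R = 0 :> K) : 2%:R = -1 :> K.
Proof. by apply/eqP; rewrite -subr_eq0 opprK -[1]/(1%:R) -natrD h3. Qed.

Lemma char3_natr2_neq0 (K : fieldType) (h3 : 3%:R = 0 :> K) : 2%:R != 0 :> K.
Proof. by rewrite char3_natr2 // oppr_eq0 oner_eq0. Qed.

Lemma char3_oppr_neq (K : fieldType) (h3 : 3%:R = 0 :> K) (x : K) :
  (x == - x) = (x == 0).
Proof.
rewrite -subr_eq0 opprK -mulr2n -mulr_natl mulf_eq0.
by rewrite (negPf (char3_natr2_neq0 h3)).
Qed.

(** * The quadratic character *)

Definition is_square (K : finFieldType) (x : K) : bool := [exists y : K, y ^+ 2 == x].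

Definition chi (K : finFieldType) (x : K) : int :=
  if x == 0 then 0 else if is_square x then 1 else -1.

Section QuadraticCharacter.
Variable K : finFieldType.
Hypothesis h3 : 3%:R = 0 :> K.

Lemma is_squareP (x : K) : reflect (exists y, y ^+ 2 = x) (is_square x).
Proof. by apply: (iffP existsP) => -[y /eqP yx]; exists y => //; apply/eqP. Qed.

Lemma chi0 : chi (0 : K) = 0.
Proof. by rewrite /chi eqxx. Qed.

Lemma chi_sqr (x : K) : x != 0 -> chi (x ^+ 2) = 1.
Proof.
move=> x0; rewrite /chi expf_eq0 (negPf x0) andbF.
by case: ifP => // /is_squareP []; exists x.
Qed.

Lemma chi_le1 (x : K) : chi x <= 1.
Proof. by rewrite /chi; case: eqP => // _; case: ifP. Qed.

Lemma chi_eq1P (x : K) : reflect (exists2 y, y != 0 & x = y ^+ 2) (chi x == 1).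
Proof.
apply: (iffP eqP) => [|[y y0 ->]]; last exact: chi_sqr.
rewrite /chi; case: eqVneq => // x0; case: ifP => // /is_squareP[y yx] _.
by exists y => //; apply: contraNneq x0 => y0; rewrite -yx y0 expr0n.
Qed.

Lemma chi_eq0 (x : K) : (chi x == 0) = (x == 0).
Proof. by rewrite /chi; case: ifP => // _; case: ifP. Qed.

Lemma chi_cases (x : K) : [|| chi x == 0, chi x == 1 | chi x == -1].
Proof. by rewrite /chi; case: ifP => // _; case: ifP. Qed.

Lemma is_square_sqrM (k x : K) : k != 0 -> is_square (k ^+ 2 * x) = is_square x.
Proof.
move=> k0; apply/is_squareP/is_squareP => -[y yx].
  by exists (y / k); rewrite expr_div_n yx mulrAC divff ?mul1r ?expf_neq0.
by exists (k * y); rewrite exprMn yx.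
Qed.

Lemma chi_sqrM (k x : K) : k != 0 -> chi (k ^+ 2 * x) = chi x.
Proof.
move=> k0; rewrite /chi is_square_sqrM // mulf_eq0 expf_eq0 (negPf k0) andbF.
by [].
Qed.

Lemma chi_exp3 (x : K) : chi (x ^+ 3) = chi x.
Proof.
have [->|x0] := eqVneq x 0; first by rewrite expr0n.
by rewrite exprSr chi_sqrM.
Qed.

Lemma card_sqrt (D : K) : #|[set x : K | x ^+ 2 == D]|%:Z = 1 + chi D.
Proof.
rewrite /chi; have [->|D0] := eqVneq D 0.
  rewrite (_ : [set x | _] = [set 0]) ?cards1 //.
  by apply/setP => x; rewrite !inE expf_eq0.
case: ifP => [/is_squareP[y yD]|/negbT nsq].
  rewrite (_ : [set x | _] = [set y; - y]).
    rewrite cards2 char3_oppr_neq //.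
    by move: D0; rewrite -yD expf_eq0 /= => ->.
  by apply/setP => x; rewrite !inE -yD eqf_sqr.
rewrite (_ : [set x | _] = set0) ?cards0 //.
apply/setP => x; rewrite !inE; apply/negP => xD.
by move/is_squareP: nsq; apply; exists x; apply/eqP.
Qed.

(** Counting the elements of [K] by their squares gives [#|K|] as the sum of [1 + chi D] over all
    [D]. *)
Lemma sum_chi : \sum_(x : K) chi x = 0.
Proof.
have : \sum_(x : K) (1 + chi x) = \sum_(x : K) 1.
  rewrite [RHS](partition_big (fun x : K => x ^+ 2) predT) //=.
  apply: eq_bigr => D _; rewrite -card_sqrt sumr_const pmulrn intz cardsE.
  exact: congr1.
by rewrite big_split /= => /eqP; rewrite -subr_eq0 addrAC subrr add0r => /eqP.
Qed.

Lemma card_squares :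
  #|[set x : K | chi x == 1]| = #|[set x : K | chi x == -1]|.
Proof.
have E v : #|[set x : K | chi x == v]|%:Z = \sum_(x : K) (if chi x == v then 1 else 0).
  by rewrite -big_mkcond sumr_const pmulrn intz cardsE.
apply/eqP; rewrite -eqz_nat -subr_eq0 -[X in _ == X]sum_chi !E -sumrB.
apply/eqP; apply: eq_bigr => x _.
by case/or3P: (chi_cases x) => /eqP ->.
Qed.

(** Multiplication by the nonsquare [x] maps the nonzero squares injectively into the nonsquares.
    The two sets have the same size, so [y = x u] with [u] a nonzero square, and [x y = x^2 u]. *)
Lemma chi_mul_nonsquare (x y : K) : chi x = -1 -> chi y = -1 -> chi (x * y) = 1.
Proof.
move=> hx hy.
have x0 : x != 0 by rewrite -chi_eq0 hx.
have /subset_cardP : #|[set x * u | u in [set u | chi u == 1]]|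
                     = #|[set u : K | chi u == -1]|.
  by rewrite card_imset ?card_squares //; apply: mulfI.
have sub : [set x * u | u in [set u | chi u == 1]] \subset [set u : K | chi u == -1].
  apply/subsetP => _ /imsetP[u + ->]; rewrite !inE => /chi_eq1P[v v0 ->].
  by rewrite mulrC chi_sqrM ?hx.
move/(_ sub)/(_ y); rewrite inE hy eqxx => /imsetP[u + ->].
rewrite inE => /chi_eq1P[v v0 ->].
by rewrite mulrA -expr2 -exprMn chi_sqr ?mulf_neq0.
Qed.

End QuadraticCharacter.

(** * Character sums of quartic forms *)

Definition quartic_value (K : fieldType) (c a z d b s t : K) : K :=
  c * s ^+ 4 + a * s ^+ 3 * t + z * s ^+ 2 * t ^+ 2 + d * s * t ^+ 3 + b * t ^+ 4.

(* The sum over the points (s : t) of the projective line, (1 : 0) first. *)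
Definition quartic_sum (K : finFieldType) (c a z d b : K) : int :=
  chi c + \sum_(s : K) chi (quartic_value c a z d b s 1).

(** For [c = 1] this is the classical resolvent cubic with 4 = 1, [y] replaced by [-y] and the
    overall sign changed. *)
Definition resolvent (K : fieldType) (c a z d b y : K) : K :=
  y ^+ 3 + z * y ^+ 2 + (a * d - c * b) * y + (c * d ^+ 2 + a ^+ 2 * b - z * c * b).

Definition resolvent_sum (K : finFieldType) (c a z d b : K) : int :=
  \sum_(y : K) chi (resolvent c a z d b y).

Section QuarticSums.
Variable K : finFieldType.
Hypothesis h3 : 3%:R = 0 :> K.

(* The substitution s -> s + s0 t followed by the exchange of s and t; it moves
   the point (s0 : 1) to infinity. *)
Lemma quartic_sum_move (c a z d b s0 : K) :
  quartic_sum c a z d b =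
  quartic_sum (quartic_value c a z d b s0 1) (c * s0 ^+ 3 - z * s0 + d) z (a + c * s0) c.
Proof.
rewrite /quartic_sum.
rewrite [X in _ + X](reindex_inj (addIr s0)) (bigD1 (0 : K)) //=.
rewrite [X in _ = _ + X](bigD1 (0 : K)) //= add0r.
set T := \sum_(i | _) _; set T' := \sum_(i | _) _.
suff -> : T = T'.
  rewrite [in RHS]/quartic_value !(mulr0, expr0n, add0r, expr1n, mulr1) /=.
  by rewrite addrCA /quartic_value !(expr1n, mulr1).
(* Inversion matches the points other than 0 and infinity; the values then differ by the factor
   [s^4], a square. *)
rewrite {}/T {}/T' [LHS](reindex_inj (@invr_inj K)) /=.
apply: eq_big => [s|s]; rewrite invr_eq0 // => s0n.
rewrite -(@chi_sqrM _ (s ^+ 2)) ?expf_neq0 //; congr chi.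
have e : s * s^-1 = 1 by rewrite divff.
set v := s^-1 in e *.
rewrite /quartic_value.
transitivity (c * ((s * v) + s * s0) ^+ 4 + a * ((s * v) + s * s0) ^+ 3 * s
  + z * ((s * v) + s * s0) ^+ 2 * s ^+ 2 + d * ((s * v) + s * s0) * s ^+ 3 + b * s ^+ 4).
  by ring.
by rewrite e; ring3 h3.
Qed.

(** The two resolvents differ by the translation of [y] by [a s0 - c s0^3], which does not affect a
    sum over all [y]. *)
Lemma resolvent_sum_move (c a z d b s0 : K) :
  resolvent_sum (quartic_value c a z d b s0 1) (c * s0 ^+ 3 - z * s0 + d) z (a + c * s0) c =
  resolvent_sum c a z d b.
Proof.
rewrite /resolvent_sum [RHS](reindex_inj (addIr (a * s0 - c * s0 ^+ 2))) /=.
apply: eq_bigr => y _; congr chi.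
by rewrite /resolvent /quartic_value; ring3 h3.
Qed.

(** When [c = 0], the resolvent at [a s] is [a^2] times the quartic at [s]. *)
Lemma quartic_sum_root_infinity (a z d b : K) : a != 0 ->
  quartic_sum 0 a z d b = resolvent_sum 0 a z d b.
Proof.
move=> a0; rewrite /quartic_sum /resolvent_sum chi0 add0r.
rewrite [RHS](reindex_inj (mulfI a0)) /=; apply: eq_bigr => s _.
rewrite -(chi_sqrM _ a0); congr chi.
by rewrite /resolvent /quartic_value; ring.
Qed.

Lemma card_sum_fibers (P : pred (K * K)) :
  #|[set u | P u]|%:Z = \sum_(s : K) #|[set w | P (s, w)]|%:Z.
Proof.
have E (T : finType) (Q : pred T) : #|[set u | Q u]|%:Z = \sum_(u : T) (if Q u then 1 else 0).
  by rewrite -big_mkcond sumr_const pmulrn intz cardsE.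
rewrite E (eq_bigr _ (fun s _ => E _ _)) pair_big /=.
by apply: eq_bigr => -[].
Qed.

Lemma card_swap (P : pred (K * K)) :
  #|[set u | P u]| = #|[set u | P (u.2, u.1)]|.
Proof.
have inj : injective (fun u : K * K => (u.2, u.1)) by move=> [? ?] [? ?] [-> ->].
rewrite -(card_imset _ inj); apply: eq_card => -[u v].
rewrite inE /=; apply/imsetP/idP => [[[u' v'] + [-> ->]]|h]; first by rewrite inE.
by exists (v, u); rewrite ?inE.
Qed.

(** Since 4 = 1 the discriminant is [B^2 - A C]; the square is completed by [A s - B], which is
    [-(2 A s + B)]. *)
Lemma card_quadratic_roots (A B C : K) : A != 0 ->
  #|[set s : K | A * s ^+ 2 + B * s + C == 0]|%:Z = 1 + chi (B ^+ 2 - A * C).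
Proof.
move=> A0; rewrite -card_sqrt //.
have inj : injective (fun s : K => A * s - B).
  by move=> s t /= /addIr/(mulfI A0).
rewrite -(card_imset _ inj); congr (Posz _); apply: eq_card => x; rewrite inE.
have E s : (A * s - B) ^+ 2 - (B ^+ 2 - A * C) = A * (A * s ^+ 2 + B * s + C).
  by ring3 h3.
apply/imsetP/idP => [[s + ->]|].
  by rewrite inE => /eqP es; rewrite -subr_eq0 E es mulr0.
have -> : x = A * ((x + B) / A) - B by rewrite mulrC divfK // addrK.
rewrite -subr_eq0 E mulf_eq0 (negPf A0) /= => h.
by exists ((x + B) / A); rewrite // inE.
Qed.

(** The count, 0 or 1, is written as [chi (B^2)] to match the resolvent at the value of [u] where
    the quadratic in [s] degenerates. *)
Lemma card_linear_roots (B C : K) : (B != 0) || (C != 0) ->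
  #|[set s : K | B * s + C == 0]|%:Z = chi (B ^+ 2).
Proof.
have [->|B0 _] := eqVneq B 0.
  rewrite /= => C0; rewrite expr0n chi0 (_ : [set s | _] = set0) ?cards0 //.
  by apply/setP => s; rewrite !inE mul0r add0r (negPf C0).
rewrite chi_sqr // (_ : [set s | _] = [set - C / B]) ?cards1 //.
apply/setP => s; rewrite !inE addr_eq0 -(inj_eq (mulIf B0) s) divfK //.
by rewrite mulrC.
Qed.

(* With w = omega s^2 + p s + u, where 2 omega p = a, the equation
   w^2 = f(s, 1) becomes quadratic in s, with discriminant R_f(omega u) up to
   the square factor omega^2. *)
Lemma quartic_sum_square_infinity (w a z d b : K) : w != 0 ->
  (forall p u : K, a = 2%:R * w * p -> z = p ^+ 2 + 2%:R * w * u ->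
     d = 2%:R * p * u -> b = u ^+ 2 -> False) ->
  quartic_sum (w ^+ 2) a z d b = resolvent_sum (w ^+ 2) a z d b.
Proof.
move=> w0 nsq; rewrite /quartic_sum chi_sqr //.
(* Since 2 = -1, this solves [2 w p = a], so that in [Q] the terms in [s^4] and [s^3] cancel. *)
set p := - a / w.
have ea : a = - (w * p) by rewrite /p mulrC divfK // opprK.
pose Q (s u : K) := (z - p ^+ 2 + w * u) * s ^+ 2 + (d + p * u) * s + (b - u ^+ 2).
have EQ s u : quartic_value (w ^+ 2) a z d b s 1 - (w * s ^+ 2 + p * s + u) ^+ 2 = Q s u.
  by rewrite /quartic_value /Q ea; ring3 h3.
(* For fixed [s], the shift of [u] by [w s^2 + p s] turns the zeros of [Q] into the square roots of
   the quartic value. *)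
have N1 : #|[set v : K * K | Q v.1 v.2 == 0]|%:Z =
    #|K|%:Z + \sum_(s : K) chi (quartic_value (w ^+ 2) a z d b s 1).
  rewrite card_sum_fibers /= -[#|K|%:Z]intz -[_%:~R]sumr_const -big_split /=.
  apply: eq_bigr => s _; rewrite -card_sqrt //; congr (Posz _).
  rewrite -[LHS](card_imset _ (addrI (w * s ^+ 2 + p * s))).
  apply: eq_card => x; rewrite !inE; apply/imsetP/idP => [[u + ->]|].
    by rewrite inE -EQ subr_eq0 eq_sym.
  move=> /eqP ex; exists (x - (w * s ^+ 2 + p * s)); last by rewrite addrC subrK.
  by rewrite inE -EQ addrC [_ + (x - _)]addrC subrK ex addrC subrr.
(* At [u0] the coefficient of [s^2] in [Q] vanishes; for every other [u] the discriminant counts the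
   roots in [s]. *)
pose u0 := - (z - p ^+ 2) / w.
have N2 : #|[set v : K * K | Q v.1 v.2 == 0]|%:Z =
    #|K|%:Z - 1 + resolvent_sum (w ^+ 2) a z d b.
  rewrite card_swap card_sum_fibers /= /resolvent_sum.
  rewrite [X in _ + X](reindex_inj (mulfI w0)) /=.
  rewrite [in LHS](bigD1 u0) //= [in RHS](bigD1 u0) //=.
  have cK : \sum_(u : K | u != u0) 1 = #|K|%:Z - 1.
    apply/eqP; rewrite eq_sym subr_eq addrC; apply/eqP.
    have -> : #|K|%:Z = \sum_(u : K) 1 by rewrite sumr_const pmulrn intz.
    by rewrite (bigD1 u0).
  have ER u : resolvent (w ^+ 2) a z d b (w * u) =
      w ^+ 2 * ((d + p * u) ^+ 2 - (z - p ^+ 2 + w * u) * (b - u ^+ 2)).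
    by rewrite /resolvent ea; ring3 h3.
  have eu0 : z - p ^+ 2 + w * u0 = 0.
    by rewrite /u0 mulrC divfK // addrN.
  rewrite ER chi_sqrM // eu0 mul0r subr0 -cK.
  rewrite [in LHS](eq_bigr (fun u => 1 + chi (resolvent (w ^+ 2) a z d b (w * u)))); last first.
    move=> u uu0; rewrite ER chi_sqrM // -card_quadratic_roots //.
    by apply: contraNneq uu0 => e; apply/eqP/(mulfI w0)/(addrI (z - p ^+ 2)); rewrite e eu0.
  rewrite big_split /= addrCA; congr (_ + (_ + _)).
  rewrite -(@card_linear_roots _ (b - u0 ^+ 2)).
    by congr (Posz _); apply: eq_card => s; rewrite !inE /Q eu0 mul0r add0r.
  (* If [Q] at [u0] were identically zero in [s], the quartic would be the square of
     [w s^2 + p s + u0]. *)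
  apply: contraT; rewrite negb_or !negbK => /andP[/eqP ed /eqP eb].
  case: (nsq p u0).
  - by rewrite ea; ring3 h3.
  - by apply/eqP; rewrite -subr_eq0 -eu0; apply/eqP; ring3 h3.
  - by apply/eqP; rewrite -subr_eq0 -ed; apply/eqP; ring3 h3.
  - by apply/eqP; rewrite -subr_eq0 -eb.
apply: (addrI (#|K|%:Z - 1)); rewrite -N2 N1; ring.
Qed.

(** The equations compare the coefficients of [k f] with those of [(w s^2 + p s t + u t^2)^2]. The
    factor [k] makes the condition invariant under scaling, which the case of nonsquare values
    uses. *)
Definition nonsquare_form (c a z d b : K) : Prop :=
  forall k w p u : K, k != 0 -> k * c = w ^+ 2 -> k * a = 2%:R * w * p ->
    k * z = p ^+ 2 + 2%:R * w * u -> k * d = 2%:R * p * u -> k * b = u ^+ 2 -> False.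

Lemma quartic_sum_square_value (c a z d b s0 : K) : nonsquare_form c a z d b ->
  chi (quartic_value c a z d b s0 1) = 1 ->
  quartic_sum c a z d b = resolvent_sum c a z d b.
Proof.
move=> nsq /eqP/chi_eq1P[w w0 ew].
rewrite (quartic_sum_move _ _ _ _ _ s0) -(resolvent_sum_move _ _ _ _ _ s0) ew.
apply: quartic_sum_square_infinity => // p u ea ez ed eb.
have {}ed : a = 2%:R * p * u - c * s0 by rewrite -ed addrK.
have {}ea : d = 2%:R * w * p - c * s0 ^+ 3 + z * s0 by rewrite -ea; ring.
have ebb : b = w ^+ 2 - c * s0 ^+ 4 - a * s0 ^+ 3 - z * s0 ^+ 2 - d * s0.
  by rewrite -ew /quartic_value; ring.
(* The witness is the square root of the moved form with the substitution undone:
   [w T^2 + p T (S - s0 T) + u (S - s0 T)^2]. *)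
apply: (nsq 1 u (p - 2%:R * u * s0) (w - p * s0 + u * s0 ^+ 2));
  rewrite ?oner_eq0 ?mul1r //.
- by rewrite ed eb; ring3 h3.
- by rewrite ez; ring3 h3.
- by rewrite ea ez eb; ring3 h3.
- by rewrite ebb ea ed ez eb; ring3 h3.
Qed.

(** The first two hypotheses say that the zeros over [K], at infinity and affine, are simple:
    [c s^3 - z s + d] is the derivative in characteristic 3. It becomes the second coefficient once
    the zero is moved to infinity. *)
Lemma quartic_sum_eq (c a z d b : K) :
  (c = 0 -> a != 0) ->
  (forall s, quartic_value c a z d b s 1 = 0 -> c * s ^+ 3 - z * s + d != 0) ->
  nonsquare_form c a z d b ->
  quartic_sum c a z d b = resolvent_sum c a z d b.
Proof.
move=> root_inf root_aff nsq.
have [c0|c0] := eqVneq c 0.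
  by rewrite c0; apply: quartic_sum_root_infinity; apply: root_inf.
have [/existsP[s0 /eqP es0]|/existsPn nroot] :=
    boolP [exists s : K, quartic_value c a z d b s 1 == 0].
  rewrite (quartic_sum_move _ _ _ _ _ s0) -(resolvent_sum_move _ _ _ _ _ s0) es0.
  exact/quartic_sum_root_infinity/root_aff.
have [/existsP[s0 /eqP es0]|/existsPn nsquare] :=
    boolP [exists s : K, chi (quartic_value c a z d b s 1) == 1].
  exact: quartic_sum_square_value es0.
have [/chi_eq1P[w w0 ew]|c1] := boolP (chi c == 1).
  rewrite ew; apply: quartic_sum_square_infinity => // p u ea ez ed eb.
  by apply: (nsq 1 w p u); rewrite ?oner_eq0 ?mul1r.
have {}c1 : chi c = -1.
  by case/or3P: (chi_cases c) => /eqP // /eqP; rewrite ?(negPf c1) // chi_eq0 (negPf c0).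
have all_nonsq s : chi (quartic_value c a z d b s 1) = -1.
  case/or3P: (chi_cases (quartic_value c a z d b s 1)) => /eqP // /eqP.
    by rewrite chi_eq0 (negPf (nroot s)).
  by rewrite (negPf (nsquare s)).
(* All values are nonsquares: then c f only takes square values, whence
   q + 1 <= q. *)
have : quartic_sum (c ^+ 2) (c * a) (c * z) (c * d) (c * b) =
       resolvent_sum (c ^+ 2) (c * a) (c * z) (c * d) (c * b).
  apply: quartic_sum_square_infinity => // p u ea ez ed eb.
  by apply: (nsq c c p u); rewrite // expr2.
have -> : quartic_sum (c ^+ 2) (c * a) (c * z) (c * d) (c * b) = 1 + \sum_(s : K) 1.
  rewrite /quartic_sum chi_sqr //; congr (_ + _); apply: eq_bigr => s _.
  rewrite -(chi_mul_nonsquare h3 c1 (all_nonsq s)); congr chi.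
  by rewrite /quartic_value; ring.
have : resolvent_sum (c ^+ 2) (c * a) (c * z) (c * d) (c * b) <= \sum_(s : K) 1.
  by apply: ler_sum => y _; apply: chi_le1.
by move=> + e; rewrite -e gerDr.
Qed.

(** The cubic [y^3 + y^2 - 1/r] at [y - (a d - c b)] is the resolvent at [y]; the extra 1 is the
    point at infinity. *)
Lemma card_E_resolvent_sum (c a d b r : K) :
  r^-1 = (c * b - a * d) ^+ 3 + (c * b - a * d) ^+ 2
           - (c * d ^+ 2 + b * a ^+ 2 - c * b) ->
  (card_E r)%:Z = #|K|%:Z + 1 + resolvent_sum c a 1 d b.
Proof.
move=> er; rewrite /card_E -addn1 PoszD addrAC; congr (_ + 1).
rewrite card_swap card_sum_fibers /= /resolvent_sum.
have -> : #|K|%:Z = \sum_(u : K) 1 by rewrite sumr_const pmulrn intz.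
rewrite -big_split /= (reindex_inj (subIr (a * d - c * b))) /=.
apply: eq_bigr => y _; rewrite card_sqrt // er; congr (1 + chi _).
by rewrite /resolvent; ring3 h3.
Qed.

End QuarticSums.

(** * Tangents and chords of the twisted cubic *)

Section Vectors.
Variable K : fieldType.
Implicit Types (s t : K) (y u v : 'rV[K]_4).

Lemma row4_eq u v : u 0 0 = v 0 0 -> u 0 1 = v 0 1 -> u 0 2 = v 0 2 -> u 0 3 = v 0 3 ->
  u = v.
Proof.
move=> e0 e1 e2 e3; apply/rowP => -[[|[|[|[|//]]]] i].
- by have -> : Ordinal i = 0 by exact/val_inj.
- by have -> : Ordinal i = 1 by exact/val_inj.
- by have -> : Ordinal i = 2 by exact/val_inj.
- by have -> : Ordinal i = 3 by exact/val_inj.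
Qed.

Lemma nuE s t : (nu s t 0 0 = s ^+ 3) * (nu s t 0 1 = s ^+ 2 * t) *
  (nu s t 0 2 = s * t ^+ 2) * (nu s t 0 3 = t ^+ 3).
Proof. by do !split; rewrite !mxE /= ?expr0 ?mulr1 ?mul1r. Qed.

Lemma tangent_dirE s t : (tangent_dir s t 0 0 = 0) * (tangent_dir s t 0 1 = s) *
  (tangent_dir s t 0 2 = - t) * (tangent_dir s t 0 3 = 0).
Proof. by do !split; rewrite !mxE /= ?(mulr0, mulr1, subr0, sub0r, oppr0). Qed.

Lemma comb2E a b u v i : (a *: u + b *: v) 0 i = a * u 0 i + b * v 0 i.
Proof. by rewrite !mxE. Qed.

Lemma sub_row2P y u v :
  reflect (exists a b, y = a *: u + b *: v) (y <= u + v)%MS.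
Proof.
apply: (iffP sub_addsmxP) => [[[a b] /= ->]|[a [b ->]]].
  by exists (a 0 0), (b 0 0); rewrite [a in LHS]mx11_scalar [b in LHS]mx11_scalar !mul_scalar_mx.
by exists (a%:M, b%:M); rewrite /= !mul_scalar_mx.
Qed.

Definition hess0 y := y 0 0 * y 0 2 - y 0 1 ^+ 2.
Definition hess1 y := y 0 0 * y 0 3 - y 0 1 * y 0 2.
Definition hess2 y := y 0 1 * y 0 3 - y 0 2 ^+ 2.

(* The Hessian of the binary cubic with coefficients y vanishes at the ends of
   the chord through y; this is its discriminant. *)
Definition hess_disc y := hess1 y ^+ 2 - hess2 y * hess0 y.

(** Here [hess0 X^2 - hess1 X + hess2] factors as [m (s1 X - t1) (s2 X - t2)], whose roots are the
    slopes of the two ends. *)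
Lemma hess_chord s1 t1 s2 t2 a b :
  let y := a *: nu s1 t1 + b *: nu s2 t2 in
  let m := a * b * (s1 * t2 - s2 * t1) ^+ 2 in
  [/\ hess0 y = m * (s1 * s2), hess1 y = m * (s1 * t2 + s2 * t1)
    & hess2 y = m * (t1 * t2)].
Proof.
move=> y m; rewrite /hess0 /hess1 /hess2 /y !comb2E !nuE /m.
by split; ring.
Qed.

(** The coordinates of a point on the chord have the form [a r1^i + b r2^i], the general solution of
    this recurrence; [y_0] and [y_1] determine [a] and [b]. *)
Lemma chord_recurrence y (r1 r2 : K) : r1 != r2 ->
  y 0 2 = (r1 + r2) * y 0 1 - r1 * r2 * y 0 0 ->
  y 0 3 = (r1 + r2) * y 0 2 - r1 * r2 * y 0 1 ->
  exists a b, y = a *: nu 1 r1 + b *: nu 1 r2.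
Proof.
move=> r12 e2 e3.
have d0 : r1 - r2 != 0 by rewrite subr_eq0.
exists ((y 0 1 - r2 * y 0 0) / (r1 - r2)), ((r1 * y 0 0 - y 0 1) / (r1 - r2)).
by apply: row4_eq; rewrite comb2E !nuE ?e3 ?e2; field.
Qed.

(** The three Hessian coefficients are the 2x2 minors of the matrix with rows [(y_0, y_1, y_2)] and
    [(y_1, y_2, y_3)]. Expanding a 3x3 determinant with a repeated row gives each relation. *)
Lemma hess_recurrence y :
  hess0 y * y 0 2 = hess1 y * y 0 1 - hess2 y * y 0 0 /\
  hess0 y * y 0 3 = hess1 y * y 0 2 - hess2 y * y 0 1.
Proof. by rewrite /hess0 /hess1 /hess2; split; ring. Qed.

Hypothesis h3 : 3%:R = 0 :> K.

Lemma cube_inj : injective (fun x : K => x ^+ 3).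
Proof.
move=> x y /= e; apply/eqP; rewrite -subr_eq0.
have : (x - y) ^+ 3 = 0 by transitivity (x ^+ 3 - y ^+ 3); [ring3 h3 | rewrite e subrr].
by move/eqP; rewrite expf_eq0.
Qed.

Lemma hess_disc_chord s1 t1 s2 t2 a b :
  hess_disc (a *: nu s1 t1 + b *: nu s2 t2) =
  (a * b * (s1 * t2 - s2 * t1) ^+ 3) ^+ 2.
Proof.
have [e0 e1 e2] := hess_chord s1 t1 s2 t2 a b.
by rewrite /hess_disc e0 e1 e2; ring3 h3.
Qed.

Lemma hess_disc_tangent s t a b : hess_disc (a *: nu s t + b *: tangent_dir s t) = 0.
Proof.
by rewrite /hess_disc /hess0 /hess1 /hess2 !comb2E !nuE !tangent_dirE; ring3 h3.
Qed.

(** The mixed terms cancel modulo 3, leaving [y_0^2 y_3^2 + y_1^3 y_3 + y_0 y_2^3], a sum of cubes.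
    This is why the discriminant along a line is the cube of a quartic. *)
Lemma hess_disc_cube y s t : y 0 0 = s ^+ 3 -> y 0 3 = t ^+ 3 ->
  hess_disc y = (s * y 0 2 + t * y 0 1 + s ^+ 2 * t ^+ 2) ^+ 3.
Proof.
by rewrite /hess_disc /hess0 /hess1 /hess2 => -> ->; ring3 h3.
Qed.

Lemma tangent_hess_disc0 y s t : y 0 0 = s ^+ 3 -> y 0 3 = t ^+ 3 ->
  (s != 0) || (t != 0) -> hess_disc y = 0 ->
  exists b, y = nu s t + b *: tangent_dir s t.
Proof.
move=> e0 e3 st0; rewrite (hess_disc_cube e0 e3) => /eqP; rewrite expf_eq0 /= => /eqP h.
(* [y] and [nu s t] agree in the outer coordinates. The vanishing of the discriminant makes the
   middle differences [(m1, m2)] proportional to [(s, -t)]. *)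
pose m1 := y 0 1 - s ^+ 2 * t; pose m2 := y 0 2 - s * t ^+ 2.
have hm : s * m2 + t * m1 = 0 by rewrite -h /m1 /m2; ring3 h3.
have [b e1 e2] : exists2 b, m1 = b * s & m2 = - (b * t).
  case/orP: st0 => [s0|t0].
    exists (m1 / s); first by rewrite divfK.
    apply: (mulfI s0); apply/eqP; rewrite -subr_eq0 -[X in _ == X]hm; apply/eqP.
    by field.
  exists (- m2 / t); last by rewrite divfK // opprK.
  apply: (mulfI t0); apply/eqP; rewrite -subr_eq0 -[X in _ == X]hm; apply/eqP.
  by field.
exists b; rewrite -[nu s t]scale1r; apply: row4_eq;
  rewrite comb2E !nuE !tangent_dirE ?e0 ?e3 ?mulr0 ?addr0 ?mul1r //.
  by rewrite -e1 /m1 addrC subrK.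
by rewrite mulrN -e2 /m2 addrC subrK.
Qed.

(* The slopes of the two ends of the chord are the roots of
   hess0 X^2 - hess1 X + hess2. *)
Lemma chord_slopes y (d : K) : hess0 y != 0 -> d != 0 -> hess_disc y = d ^+ 2 ->
  let r1 := - (hess1 y + d) / hess0 y in
  let r2 := - (hess1 y - d) / hess0 y in
  r1 != r2 /\ exists a b, y = a *: nu 1 r1 + b *: nu 1 r2.
Proof.
move=> A0 d0 ed r1 r2.
have [] := hess_recurrence y.
move: ed; rewrite /hess_disc /r1 /r2 {r1 r2}.
set A := hess0 y in A0 *; set B := hess1 y; set C := hess2 y => ed e2 e3.
have sumr : - (B + d) / A + - (B - d) / A = B / A.
  apply: (mulIf A0); rewrite mulrDl !divfK //; ring3 h3.
have prodr : (- (B + d) / A) * (- (B - d) / A) = C / A.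
  apply: (mulIf A0); apply: (mulIf A0).
  transitivity (B ^+ 2 - d ^+ 2); first by field.
  by rewrite -ed; field.
have r12 : - (B + d) / A != - (B - d) / A.
  apply: contraNneq d0 => /(mulIf (invr_neq0 A0))/oppr_inj/addrI/eqP.
  by rewrite char3_oppr_neq.
split=> //; apply: chord_recurrence => //; rewrite sumr prodr.
  by apply: (mulfI A0); rewrite e2; field.
by apply: (mulfI A0); rewrite e3; field.
Qed.

(** One root of the Hessian is at infinity, so one end of the chord is [nu 0 1]; the first three
    coordinates form a geometric progression whose ratio is the other slope. *)
Lemma chord_slope_infinity y : hess0 y = 0 -> hess1 y != 0 ->
  exists a b, y = a *: nu 1 (hess2 y / hess1 y) + b *: nu 0 1.
Proof.
move=> A0 B0; have [] := hess_recurrence y; rewrite A0 !mul0r => e1 e2.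
set r := _ / _.
have {}e1 : y 0 1 = r * y 0 0.
  apply: (mulfI B0); rewrite mulrA [_ * r]mulrC divfK //.
  by apply/eqP; rewrite -subr_eq0 -e1.
have {}e2 : y 0 2 = r * y 0 1.
  apply: (mulfI B0); rewrite mulrA [_ * r]mulrC divfK //.
  by apply/eqP; rewrite -subr_eq0 -e2.
exists (y 0 0), (y 0 3 - y 0 0 * r ^+ 3).
by apply: row4_eq; rewrite comb2E !nuE ?e2 ?e1; ring.
Qed.

Lemma nu_scale (l s t : K) : nu (l * s) (l * t) = l ^+ 3 *: nu s t.
Proof. by apply: row4_eq; rewrite [RHS]mxE !nuE; ring. Qed.

Lemma pair_neq0 s t : ((s, t) != (0, 0)) = (s != 0) || (t != 0).
Proof. by rewrite xpair_eqE negb_and. Qed.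

Lemma proportional s1 t1 s2 t2 : (s1, t1) != (0, 0) -> (s2, t2) != (0, 0) ->
  s1 * t2 = s2 * t1 -> exists2 l, l != 0 & s1 = l * s2 /\ t1 = l * t2.
Proof.
rewrite !pair_neq0 => h1 h2 e.
have [s20|s20] := eqVneq s2 0.
  move: h2 e; rewrite s20 eqxx mul0r /= => t20 /eqP.
  rewrite mulf_eq0 (negPf t20) orbF => /eqP s10.
  move: h1; rewrite s10 eqxx /= => t10.
  by exists (t1 / t2); [rewrite mulf_neq0 ?invr_neq0 | rewrite mulr0 divfK].
have s1n : s1 != 0.
  apply: contraTneq h1 => s10; move: e; rewrite s10 mul0r => /esym/eqP.
  by rewrite mulf_eq0 (negPf s20) eqxx /= => ->.
exists (s1 / s2); first by rewrite mulf_neq0 ?invr_neq0.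
by split; rewrite ?divfK // mulrAC e mulrAC divff ?mul1r.
Qed.

Lemma genmx_scale (l : K) y : l != 0 -> <<l *: y>>%MS = <<y>>%MS.
Proof. by move=> l0; apply/eq_genmx/eqmx_scale. Qed.

Lemma genmx_rowP y v :  (<<y>>%MS = <<v>>%MS) -> exists a, y = a *: v.
Proof. by move=> e; apply/sub_rVP; rewrite -(genmxE v) -e genmxE. Qed.

Lemma nu_genmx_eq s1 t1 s2 t2 : (s1, t1) != (0, 0) -> (s2, t2) != (0, 0) ->
  (<<nu s1 t1>>%MS == <<nu s2 t2>>%MS) = (s1 * t2 == s2 * t1).
Proof.
move=> h1 h2; apply/eqP/eqP => [/genmx_rowP[a e]|].
  apply: cube_inj => /=.
  have e0 : s1 ^+ 3 = a * s2 ^+ 3 by rewrite -(nuE s1 t1) e mxE nuE.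
  have e3 : t1 ^+ 3 = a * t2 ^+ 3 by rewrite -(nuE s1 t1) e mxE nuE.
  by rewrite !exprMn e0 e3; ring.
by case/(proportional h1 h2) => l l0 [-> ->]; rewrite nu_scale genmx_scale ?expf_neq0.
Qed.

End Vectors.

(** * Real chord and tangent criteria over a finite field *)

Section FinitePoints.
Variable K : finFieldType.
Hypothesis h3 : 3%:R = 0 :> K.
Implicit Types (s t : K) (y u v : 'rV[K]_4).

Lemma mem_proj_points y : y != 0 -> <<y>>%MS \in proj_points K.
Proof. by move=> y0; apply/imsetP; exists y; rewrite ?inE. Qed.

Lemma mem_twisted_cubic s t : (s, t) != (0, 0) -> <<nu s t>>%MS \in twisted_cubic K.
Proof. by move=> st0; apply/imsetP; exists (s, t); rewrite ?inE. Qed.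

Lemma twisted_cubicP (P : 'M[K]_4) :
  P \in twisted_cubic K -> exists s t, (s, t) != (0, 0) /\ P = <<nu s t>>%MS.
Proof. by case/imsetP => -[s t]; rewrite inE => st0 ->; exists s, t. Qed.

Lemma hess_disc_cubic y : <<y>>%MS \in twisted_cubic K -> hess_disc y = 0.
Proof.
case/twisted_cubicP => s [t [_ /genmx_rowP[a ->]]].
by rewrite -[a *: _]addr0 -(scale0r (nu 0 0)) hess_disc_chord // !(mulr0, mul0r) expr0n.
Qed.

Lemma sub_genmx2 y u v : (<<y>>%MS <= <<u>>%MS + <<v>>%MS)%MS = (y <= u + v)%MS.
Proof. by rewrite genmxE (adds_eqmx (genmxE _) (genmxE _)). Qed.

Lemma axis_pointsP y : y != 0 ->
  (<<y>>%MS \in axis_points K) = (y 0 0 == 0) && (y 0 3 == 0).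
Proof.
move=> y0; apply/imsetP/idP => [[u + /genmx_rowP[a ->]]|e].
  by rewrite inE => /and3P[_ /eqP e0 /eqP e3]; rewrite !mxE e0 e3 mulr0 eqxx.
by exists y; rewrite // inE y0.
Qed.

Lemma real_chord_pointsP y : y != 0 ->
  (<<y>>%MS \in real_chord_points K) = (chi (hess_disc y) == 1).
Proof.
move=> y0; rewrite !inE mem_proj_points //=.
apply/andP/chi_eq1P => [[nC /existsP[Q /andP[/twisted_cubicP[s1 [t1 [n1 eQ]]]]]]|[d d0 ed]].
  case/existsP=> R /and3P[/twisted_cubicP[s2 [t2 [n2 eR]]]].
  rewrite {}eQ {}eR nu_genmx_eq // => n12.
  rewrite sub_genmx2 => /sub_row2P[a [b ey]].
  rewrite ey hess_disc_chord //.
  exists (a * b * (s1 * t2 - s2 * t1) ^+ 3) => //.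
  (* A zero coefficient would put the point on the cubic itself. *)
  rewrite !mulf_neq0 ?expf_neq0 ?subr_eq0 //.
    apply: contraNneq nC => a0; move: y0; rewrite ey a0 scale0r add0r => y0.
    rewrite genmx_scale ?mem_twisted_cubic //.
    by apply: contraNneq y0 => ->; rewrite scale0r.
  apply: contraNneq nC => b0; move: y0; rewrite ey b0 scale0r addr0 => y0.
  rewrite genmx_scale ?mem_twisted_cubic //.
  by apply: contraNneq y0 => ->; rewrite scale0r.
split.
  apply/negP => /hess_disc_cubic /eqP.
  by rewrite ed expf_eq0 (negPf d0).
have n1 r : (1, r) != (0, 0) :> K * K by rewrite pair_neq0 oner_eq0.
have [s1 [t1 [s2 [t2 [m1 m2 m12 my]]]]] : exists s1 t1 s2 t2 : K,
    [/\ (s1, t1) != (0, 0), (s2, t2) != (0, 0), s1 * t2 != s2 * t1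
      & exists a b, y = a *: nu s1 t1 + b *: nu s2 t2].
  have [A0|A0] := eqVneq (hess0 y) 0.
    exists 1, (hess2 y / hess1 y), 0, 1; split=> //.
    - by rewrite pair_neq0 oner_eq0 orbT.
    - by rewrite mul0r mulr1 oner_eq0.
    apply: chord_slope_infinity => //; apply: contraNneq d0 => B0.
    by rewrite -sqrf_eq0 -ed /hess_disc A0 B0 expr0n mulr0 subr0.
  have [r12 ey] := chord_slopes h3 A0 d0 ed.
  by do 4!eexists; split; last exact: ey; rewrite // !mul1r eq_sym.
apply/existsP; exists <<nu s1 t1>>%MS; rewrite mem_twisted_cubic //=.
apply/existsP; exists <<nu s2 t2>>%MS; rewrite mem_twisted_cubic //=.
by rewrite nu_genmx_eq // m12 sub_genmx2; apply/sub_row2P.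
Qed.

Lemma cube_root (x : K) : exists s, x = s ^+ 3.
Proof.
have [g _ gK] := injF_bij (cube_inj h3).
by exists (g x); rewrite -[LHS]gK.
Qed.

Lemma tangent_pointsP y : y != 0 -> <<y>>%MS \notin twisted_cubic K ->
  <<y>>%MS \notin axis_points K ->
  (<<y>>%MS \in tangent_points K) = (hess_disc y == 0).
Proof.
move=> y0 nC nA; rewrite !inE (negPf nC) (negPf nA) mem_proj_points //=.
apply/existsP/eqP => [[[s t] /andP[_]]|e].
  by rewrite genmxE => /sub_row2P[a [b ->]]; apply: hess_disc_tangent.
(* The osculating plane at the point of tangency contains [y], which forces [s^3 : t^3 = y_0 : y_3];
   the ratio is defined because [y] is off the axis. *)
have [s es] := cube_root (y 0 0); have [t et] := cube_root (y 0 3).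
have st0 : (s != 0) || (t != 0).
  rewrite -negb_and; apply: contra nA; rewrite axis_pointsP // es et.
  by move=> /andP[/eqP-> /eqP->]; rewrite expr0n eqxx.
exists (s, t); rewrite pair_neq0 st0 /= genmxE; apply/sub_row2P.
have [b ->] := tangent_hess_disc0 h3 es et st0 e.
by exists 1, b; rewrite scale1r.
Qed.

End FinitePoints.

(** * The quadratic extension and imaginary chords *)

Lemma Frobenius_morphism (R : comNzRingType) (p n : nat) : p \in [pchar R] ->
  exists phi : {rmorphism R -> R}, forall x, phi x = x ^+ (p ^ n).
Proof.
move=> chp; elim: n => [|n [phi e]]; first by exists idfun => x; rewrite expr1.
exists (phi \o pFrobenius_aut chp) => x.
by rewrite /= e pFrobenius_autE -exprM -expnS.
Qed.

Section QuadraticExtension.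
Variables (n : nat) (F F2 : finFieldType) (j : {rmorphism F -> F2}).
Hypotheses (hF : #|F| = (3 ^ n)%N) (hF2 : #|F2| = (#|F| ^ 2)%N).
Let q := #|F|.

Lemma char3_card : 3%:R = 0 :> F.
Proof.
by have := card_finPcharP hF isT; rewrite inE => /andP[_ /eqP].
Qed.

Let h3 := char3_card.

Lemma char3_ext : 3%:R = 0 :> F2.
Proof. by rewrite -(rmorph_nat j) h3 rmorph0. Qed.

Let h3' := char3_ext.

Lemma pchar_ext : 3 \in [pchar F2].
Proof. by rewrite inE h3' eqxx. Qed.

(** The image of [j] consists of [q] roots of [X^q - X], and this polynomial has no more. *)
Lemma frob_fixedP (x : F2) : reflect (exists a, x = j a) (x ^+ q == x).
Proof.
apply: (iffP eqP) => [e|[a ->]]; last by rewrite -rmorphXn /= expf_card.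
pose S := [set x : F2 | x ^+ q == x].
have q1 : (1 < q)%N by apply: card_finRing_gt1.
have sS : [set j a | a in F] \subset S.
  by apply/subsetP => _ /imsetP[a _ ->]; rewrite inE -rmorphXn /= expf_card.
have cS : (#|S| <= q)%N.
  pose pol : {poly F2} := 'X^q - 'X.
  have szp : size pol = q.+1.
    by rewrite /pol size_polyDl size_polyXn // size_polyN size_polyX.
  rewrite -ltnS -szp cardE; apply: max_poly_roots.
  - by rewrite -size_poly_eq0 szp.
  - apply/allP => z; rewrite mem_enum inE => /eqP ez.
    by rewrite /root /pol !hornerE ez subrr.
  - exact: enum_uniq.
have /eqP eS : [set j a | a in F] == S.
  by rewrite eqEcard sS card_imset //; apply: fmorph_inj.
have : x \in S by rewrite inE e.
by rewrite -eS => /imsetP[a _ ->]; exists a.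
Qed.

Lemma frobK (x : F2) : (x ^+ q) ^+ q = x.
Proof. by rewrite -exprM mulnn /q -hF2 expf_card. Qed.

Lemma exists_frob : exists phi : {rmorphism F2 -> F2}, forall x, phi x = x ^+ q.
Proof. by rewrite /q hF; apply: Frobenius_morphism pchar_ext. Qed.

Lemma frob_conj_nu s t : frob_conj q <<nu s t>>%MS = <<nu (s ^+ q) (t ^+ q) : 'rV[F2]_4>>%MS.
Proof.
have [phi ephi] := exists_frob.
rewrite /frob_conj (_ : map_mx _ _ = map_mx phi <<nu s t>>%MS); last first.
  by apply/matrixP => a b; rewrite !mxE ephi.
have <- : map_mx phi (nu s t) = nu (s ^+ q) (t ^+ q); last first.
  by rewrite (eq_genmx (map_genmx phi _)) genmx_id.
by apply: row4_eq; rewrite mxE !nuE -!ephi ?rmorphM ?rmorphXn.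
Qed.

(** For [w] outside the base field, [e = w - w^q] is negated by Frobenius and [e^2] is a nonsquare
    [m] of [F]. Then [D m = k^2] is a square, and [k / e] is a square root of [D]. *)
Lemma sqrt_nonsquare (D : F) : chi D = -1 ->
  exists d : F2, [/\ d ^+ 2 = j D, d != 0 & d ^+ q = - d].
Proof.
move=> nD; have [phi ephi] := exists_frob.
have [w nw] : exists w : F2, w ^+ q != w.
  apply/existsP; rewrite -negb_forall; apply/negP => /forallP all_fix.
  have : (#|F2| <= #|[set j a | a in F]|)%N.
    apply/subset_leq_card/subsetP => x _.
    by have /frob_fixedP[a ->] := all_fix x; apply: imset_f.
  rewrite card_imset; last exact: fmorph_inj.
  by rewrite hF2 leqNgt -{1}(expn1 #|F|) ltn_exp2l ?card_finRing_gt1.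
have [tr etr] : exists tr, w + w ^+ q = j tr.
  by apply/frob_fixedP; rewrite -ephi rmorphD /= !ephi frobK addrC.
have [nm enm] : exists nm, w * w ^+ q = j nm.
  by apply/frob_fixedP; rewrite -ephi rmorphM /= !ephi frobK mulrC.
pose m := tr ^+ 2 - nm; pose e := w - w ^+ q.
have e0 : e != 0 by rewrite subr_eq0 eq_sym.
have ee : e ^+ 2 = j m.
  by rewrite /m rmorphB rmorphXn /= -etr -enm /e; ring3 h3'.
have eq_e : e ^+ q = - e.
  by rewrite -ephi rmorphB /= !ephi frobK opprB.
have nm_ : chi m = -1.
  case/or3P: (chi_cases m) => /eqP // /eqP.
    by rewrite chi_eq0 -(fmorph_eq0 j) -ee expf_eq0 (negPf e0).
  case/chi_eq1P => v v0 ev; move: ee; rewrite ev rmorphXn => /eqP.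
  rewrite eqf_sqr => h.
  have : e ^+ q = e.
    by case/orP: h => /eqP->; apply/eqP/frob_fixedP; [exists v | exists (- v); rewrite rmorphN].
  by rewrite eq_e => /esym/eqP; rewrite char3_oppr_neq // (negPf e0).
have /eqP/chi_eq1P[k k0 ek] := chi_mul_nonsquare h3 nD nm_.
exists (j k / e); split.
- rewrite expr_div_n ee -rmorphXn /= -ek rmorphM /= mulfK //.
  by rewrite -ee expf_neq0.
- by rewrite mulf_neq0 ?invr_neq0 // fmorph_eq0.
- by rewrite expr_div_n eq_e -rmorphXn /= expf_card invrN mulrN.
Qed.

(** On a chord with conjugate ends the coefficients are conjugate, so the square root [a b e^3] of
    the discriminant changes sign under Frobenius and lies outside [F]. Conversely, Frobenius
    negates the root [d] of a nonsquare discriminant and so exchanges the two slopes. *)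
Lemma imaginary_chord_pointsP (y : 'rV[F]_4) : y != 0 ->
  (<<y>>%MS \in imaginary_chord_points j) = (chi (hess_disc y) == -1).
Proof.
move=> y0; have [phi ephi] := exists_frob.
pose y' := map_mx j y.
have yE i : y' 0 i = j (y 0 i) by rewrite mxE.
have h0E : hess0 y' = j (hess0 y).
  by rewrite /hess0 !yE rmorphB rmorphM rmorphXn.
have h1E : hess1 y' = j (hess1 y).
  by rewrite /hess1 !yE rmorphB !rmorphM.
have hE : hess_disc y' = j (hess_disc y).
  by rewrite /hess_disc /hess0 /hess1 /hess2 !yE !(rmorphB, rmorphM, rmorphXn).
have subE (u v : 'rV[F2]_4) :
    (map_mx j <<y>>%MS <= <<u>>%MS + <<v>>%MS)%MS = (y' <= u + v)%MS.
  by rewrite map_genmx (adds_eqmx (genmxE _) (genmxE _)) genmxE.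
rewrite inE mem_proj_points //=.
apply/existsP/eqP => [[Q /and3P[/twisted_cubicP[s [t [n1 ->]]]]]|nsq].
  have n2 : (s ^+ q, t ^+ q) != (0, 0).
    by move: n1; rewrite !pair_neq0 -!ephi !fmorph_eq0.
  rewrite frob_conj_nu nu_genmx_eq // subE => n12 /sub_row2P[a [b ey]].
  set S := s ^+ q in n2 n12 ey; set T := t ^+ q in n2 n12 ey.
  pose e := s * T - S * t.
  have e0 : e != 0 by rewrite subr_eq0.
  have phiS : phi S = s by rewrite ephi frobK.
  have phiT : phi T = t by rewrite ephi frobK.
  have phis : phi s = S by rewrite ephi.
  have phit : phi t = T by rewrite ephi.
  clearbody S T.
  have phie : phi e = - e.
    by rewrite /e rmorphB !rmorphM phiS phiT phis phit; ring.
  have phij x : phi (j x) = j x by apply/eqP; rewrite ephi; apply/frob_fixedP; exists x.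
  have eab : a = phi b.
    have E0 : a * s ^+ 3 + b * S ^+ 3 = phi a * S ^+ 3 + phi b * s ^+ 3.
      have := phij (y 0 0); rewrite -yE ey comb2E !nuE rmorphD.
      rewrite [phi (a * _)]rmorphM [phi (b * _)]rmorphM !rmorphXn /=.
      by rewrite phis phiS addrC.
    have E3 : a * t ^+ 3 + b * T ^+ 3 = phi a * T ^+ 3 + phi b * t ^+ 3.
      have := phij (y 0 3); rewrite -yE ey comb2E !nuE rmorphD.
      rewrite [phi (a * _)]rmorphM [phi (b * _)]rmorphM !rmorphXn /=.
      by rewrite phit phiT addrC.
    apply/eqP; rewrite -subr_eq0; apply/eqP/(mulIf (expf_neq0 3 e0)).
    (* Eliminating [b - phi a] between the coordinates 0 and 3 leaves [(a - phi b) e^3]. *)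
    rewrite mul0r; transitivity
      ((a * s ^+ 3 + b * S ^+ 3 - (phi a * S ^+ 3 + phi b * s ^+ 3)) * T ^+ 3
       - (a * t ^+ 3 + b * T ^+ 3 - (phi a * T ^+ 3 + phi b * t ^+ 3)) * S ^+ 3).
      by rewrite /e; ring3 h3'.
    by rewrite E0 E3 !subrr !mul0r subr0.
  have b0 : b != 0.
    apply: contraNneq y0 => b0; rewrite -(map_mx_eq0 j) -/y' ey eab b0 rmorph0.
    by rewrite !scale0r addr0.
  have a0 : a != 0 by rewrite eab fmorph_eq0.
  have g0 : a * b * e ^+ 3 != 0 by rewrite !mulf_neq0 ?expf_neq0.
  have phig : phi (a * b * e ^+ 3) = - (a * b * e ^+ 3).
    have -> : phi (a * b * e ^+ 3) = phi a * phi b * phi e ^+ 3.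
      by rewrite rmorphM [phi (a * b)]rmorphM rmorphXn.
    have -> : phi a = b by rewrite eab !ephi frobK.
    by rewrite phie -eab; ring.
  have := hE; rewrite ey (hess_disc_chord h3') -/e => /esym eD.
  case/or3P: (chi_cases (hess_disc y)) => /eqP // /eqP.
    by rewrite chi_eq0 -(fmorph_eq0 j) eD expf_eq0 (negPf g0).
  case/chi_eq1P => v v0 ev; move/eqP: eD; rewrite ev rmorphXn eqf_sqr => h.
  have : phi (a * b * e ^+ 3) = a * b * e ^+ 3.
    case/orP: h => /eqP h; first by rewrite -h phij.
    by rewrite -[a * b * _]opprK -h -rmorphN phij.
  by rewrite phig => /esym/eqP; rewrite char3_oppr_neq // (negPf g0).
have [d [ed d0 dq]] := sqrt_nonsquare nsq.
have A0 : hess0 y != 0.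
  apply/negP => /eqP A0; have B0 : hess1 y != 0.
    apply: contra_eq_neq nsq => B0.
    by rewrite /hess_disc A0 B0 mulr0 subr0 expr0n chi0.
  by move: nsq; rewrite /hess_disc A0 mulr0 subr0 chi_sqr.
have A0' : hess0 y' != 0 by rewrite h0E fmorph_eq0.
rewrite -hE in ed; have [r12 ey] := chord_slopes h3' A0' d0 (esym ed).
set r1 := - (_ + d) / _ in r12 ey; set r2 := - (_ - d) / _ in r12 ey.
have er : r1 ^+ q = r2.
  rewrite -ephi /r1 /r2 fmorph_div rmorphN rmorphD /= !ephi dq h0E h1E.
  by rewrite -!rmorphXn /= !expf_card.
exists <<nu 1 r1>>%MS.
have n1 r : (1, r) != (0, 0) :> F2 * F2 by rewrite pair_neq0 oner_eq0.
rewrite mem_twisted_cubic //= frob_conj_nu expr1n er nu_genmx_eq // !mul1r eq_sym r12 /=.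
by rewrite subE; apply/sub_row2P.
Qed.

End QuadraticExtension.

(** * Generic lines *)

Section LineEquations.
Variable K : fieldType.
Variables x y : 'rV[K]_4.
Let z := quartic_of_line x y.

(* The point (U : aU + bV : cU + dV : V) of the line, where the quartic is
   c X^4 + a X^3 Y + X^2 Y^2 + d X Y^3 + b Y^4 after normalization. *)
Definition line_row (U V : K) : 'rV[K]_4 :=
  \row_i [:: U; z`_1 / z`_2 * U + z`_4 / z`_2 * V;
             z`_0 / z`_2 * U + z`_3 / z`_2 * V; V]`_i.

Lemma line_rowE U V : (line_row U V 0 0 = U) *
  (line_row U V 0 1 = z`_1 / z`_2 * U + z`_4 / z`_2 * V) *
  (line_row U V 0 2 = z`_0 / z`_2 * U + z`_3 / z`_2 * V) * (line_row U V 0 3 = V).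
Proof. by do !split; rewrite mxE. Qed.

Lemma line_row_scale l U V : line_row (l * U) (l * V) = l *: line_row U V.
Proof. by apply: row4_eq; rewrite [RHS]mxE !line_rowE; ring. Qed.

Hypothesis z2 : z`_2 != 0.

(** Since [p_03] is nonzero, the outer coordinates determine a vector of the line; the witnesses
    come from Cramer's rule. *)
Lemma sub_line_row (w : 'rV[K]_4) :
  (w <= x + y)%MS = (w == line_row (w 0 0) (w 0 3)).
Proof.
have z2' : x 0 0 * y 0 3 - x 0 3 * y 0 0 != 0 := z2.
apply/sub_row2P/eqP => [[al [be ->]]|->].
  by apply: row4_eq; rewrite line_rowE !comb2E /z /= /plucker; field.
exists ((y 0 3 * w 0 0 - y 0 0 * w 0 3) / z`_2), ((x 0 0 * w 0 3 - x 0 3 * w 0 0) / z`_2).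
by apply: row4_eq; rewrite comb2E line_rowE /z /= /plucker; field.
Qed.

Lemma line_row_neq0 U V : (U, V) != (0, 0) -> line_row U V != 0.
Proof.
rewrite pair_neq0; apply: contraTneq => e.
have U0 : U = 0 by rewrite -[LHS](line_rowE U V) e mxE.
have V0 : V = 0 by rewrite -[LHS](line_rowE U V) e mxE.
by rewrite U0 V0 eqxx.
Qed.

Lemma nu_sub_line s t : (nu s t <= x + y)%MS =
  (s ^+ 2 * t == z`_1 / z`_2 * s ^+ 3 + z`_4 / z`_2 * t ^+ 3) &&
  (s * t ^+ 2 == z`_0 / z`_2 * s ^+ 3 + z`_3 / z`_2 * t ^+ 3).
Proof.
rewrite sub_line_row !nuE; apply/eqP/andP => [e|[/eqP e1 /eqP e2]].
  by split; apply/eqP; rewrite -(nuE s t) e line_rowE.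
by apply: row4_eq; rewrite line_rowE nuE.
Qed.

End LineEquations.

Lemma quartic_of_line_map (K K' : fieldType) (f : {rmorphism K -> K'}) (x y : 'rV[K]_4) i :
  (quartic_of_line (map_mx f x) (map_mx f y))`_i = f (quartic_of_line x y)`_i.
Proof.
have E k l : plucker (map_mx f x) (map_mx f y) k l = f (plucker x y k l).
  by rewrite /plucker !mxE rmorphB !rmorphM.
by case: i => [|[|[|[|[|i]]]]] //=; rewrite ?E // !nth_nil rmorph0.
Qed.

(** * Points of a generic line and the values of its quartic *)

Section GenericLine.
Variables (F : finFieldType) (Fbar : closedFieldType) (iota : {rmorphism F -> Fbar}).
Hypothesis h3 : 3%:R = 0 :> F.
Variables (L : 'M[F]_4) (x y : 'rV[F]_4).
Hypothesis hgen : generic_line iota L.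
Hypothesis hLxy : (L == x + y)%MS.
Let z := quartic_of_line x y.

Lemma sub_line (m : nat) (w : 'M[F]_(m, 4)) : (w <= L)%MS = (w <= x + y)%MS.
Proof. by rewrite (eqmxP hLxy). Qed.

(** If [p_03 = 0], the pairs [(x_0, x_3)] and [(y_0, y_3)] are proportional, and the cube roots of a
    nonzero one give an osculating plane containing [L]. *)
Lemma generic_line_axis : z`_2 != 0.
Proof.
apply/negP => /eqP z2.
have e : x 0 0 * y 0 3 = x 0 3 * y 0 0 by apply/eqP; rewrite -subr_eq0 -z2.
have [s [t [st0 sx sy]]] : exists s t, [/\ (s, t) != (0, 0),
    t ^+ 3 * x 0 0 - s ^+ 3 * x 0 3 = 0 & t ^+ 3 * y 0 0 - s ^+ 3 * y 0 3 = 0].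
  have [s es] := cube_root h3 (x 0 0); have [t et] := cube_root h3 (x 0 3).
  have [u eu] := cube_root h3 (y 0 0); have [v ev] := cube_root h3 (y 0 3).
  have [st0|] := boolP ((s, t) != (0, 0)).
    exists s, t; split=> //; rewrite -es -et; first by ring.
    by rewrite -e subrr.
  rewrite negbK xpair_eqE => /andP[/eqP s0 /eqP t0].
  rewrite es et s0 t0 !expr0n /=.
  have [uv0|] := boolP ((u, v) != (0, 0)).
    exists u, v; split=> //; rewrite -?eu -?ev; first by rewrite !mulr0 subrr.
    by ring.
  rewrite negbK xpair_eqE => /andP[/eqP u0 /eqP v0].
  (* Here both points lie on the axis, which every osculating plane contains; [(1 : 0)] is an
     arbitrary choice. *)
  exists 1, 0; rewrite eu ev u0 v0 pair_neq0 oner_eq0 !expr0n /=.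
  by split; rewrite // ?mulr0 subrr.
have [w + /negP[]] := hgen.2 s t st0.
rewrite sub_line => /sub_row2P[al [be ->]].
rewrite /in_osculating_plane !comb2E; apply/eqP.
transitivity (al * (t ^+ 3 * x 0 0 - s ^+ 3 * x 0 3) + be * (t ^+ 3 * y 0 0 - s ^+ 3 * y 0 3)).
  by ring.
by rewrite sx sy !mulr0 addr0.
Qed.

Let z2 := generic_line_axis.
Let c := z`_0 / z`_2.
Let a := z`_1 / z`_2.
Let d := z`_3 / z`_2.
Let b := z`_4 / z`_2.

Lemma generic_line_cubic (s t : Fbar) : (s, t) != (0, 0) ->
  s ^+ 2 * t = iota a * s ^+ 3 + iota b * t ^+ 3 ->
  s * t ^+ 2 = iota c * s ^+ 3 + iota d * t ^+ 3 -> False.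
Proof.
move=> st0 e1 e2; have /negP[] := hgen.1 s t st0.
have -> : (nu s t <= map_mx iota L)%MS = (nu s t <= map_mx iota x + map_mx iota y)%MS.
  have /(map_eqmx iota) h := eqmxP hLxy.
  by rewrite h (map_addsmx iota x y).
rewrite nu_sub_line ?quartic_of_line_map ?fmorph_eq0 //.
by rewrite -!fmorph_div e1 e2 !eqxx.
Qed.

Definition line_quartic (s t : F) : F := quartic_value c a 1 d b s t.

(** In characteristic 3 the two equations say that both partial derivatives of the quartic vanish,
    and they are also the equations for [nu s t] to lie on [L]. Thus multiple zeros correspond to
    intersections with the cubic. *)
Lemma line_quartic_no_double_root (s t : F) : (s, t) != (0, 0) ->
  c * s ^+ 3 - s * t ^+ 2 + d * t ^+ 3 = 0 ->
  a * s ^+ 3 - s ^+ 2 * t + b * t ^+ 3 = 0 -> False.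
Proof.
rewrite pair_neq0 => st0 e1 e2; apply: (@generic_line_cubic (iota s) (iota t)).
- by rewrite pair_neq0 !fmorph_eq0.
- rewrite -!rmorphXn -!rmorphM -rmorphD /=; congr (iota _).
  by apply/esym/eqP; rewrite -subr_eq0 -e2; apply/eqP; ring.
- rewrite -!rmorphXn -!rmorphM -rmorphD /=; congr (iota _).
  by apply/esym/eqP; rewrite -subr_eq0 -e1; apply/eqP; ring.
Qed.

(** If [k f = g^2], a root of [g] is a double zero of [f], hence a point of the cubic on [L]. The
    root may lie outside [F], so disjointness over the algebraic closure enters here. *)
Lemma line_quartic_nonsquare : nonsquare_form c a 1 d b.
Proof.
have nz : c = 0 -> a = 0 -> False.
  move=> c0 a0; apply: (@line_quartic_no_double_root 1 0); rewrite ?pair_neq0 ?oner_eq0 //.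
    by rewrite c0; ring.
  by rewrite a0; ring.
move=> k w p u k0 ec ea ez ed eb.
have w0 : w != 0.
  apply/eqP => w0; apply: nz; apply: (mulfI k0).
    by rewrite ec w0 expr0n mulr0.
  by rewrite ea w0 mulr0 mul0r mulr0.
(* [s0] is a root of [w X^2 + p X + u], made monic. *)
have [s0 es] := @solve_monicpoly Fbar 2
  (fun i => if i == 0%N then - iota (u / w) else - iota (p / w)) isT.
move: es; rewrite big_ord_recl big_ord1 /= expr0 mulr1 expr1 => es.
have h3' : 3%:R = 0 :> Fbar by rewrite -(rmorph_nat iota) h3 rmorph0.
have root : iota w * s0 ^+ 2 + iota p * s0 + iota u = 0.
  by rewrite es !fmorph_div; field; rewrite fmorph_eq0.
have k0' : iota k != 0 by rewrite fmorph_eq0.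
have [ec' ea' ez' ed' eb'] : [/\ iota k * iota c = iota w ^+ 2,
    iota k * iota a = 2%:R * iota w * iota p,
    iota k = iota p ^+ 2 + 2%:R * iota w * iota u,
    iota k * iota d = 2%:R * iota p * iota u & iota k * iota b = iota u ^+ 2].
  split; first by rewrite -rmorphM ec rmorphXn.
  - by rewrite -rmorphM ea !rmorphM rmorph_nat.
  - by rewrite -[k]mulr1 ez rmorphD rmorphXn !rmorphM rmorph_nat.
  - by rewrite -rmorphM ed !rmorphM rmorph_nat.
  - by rewrite -rmorphM eb rmorphXn.
apply: (@generic_line_cubic s0 1).
- by rewrite pair_neq0 oner_eq0 orbT.
- apply: (mulfI k0'); apply/eqP; rewrite -subr_eq0; apply/eqP.
  transitivity (iota k * s0 ^+ 2 - iota k * iota a * s0 ^+ 3 - iota k * iota b); first by ring.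
  rewrite ea' eb' ez'.
  transitivity ((iota w * s0 ^+ 2 + iota p * s0 + iota u) * (iota p * s0 - iota u)).
    by ring3 h3'.
  by rewrite root mul0r.
- apply: (mulfI k0'); apply/eqP; rewrite -subr_eq0; apply/eqP.
  transitivity (iota k * s0 - iota k * iota c * s0 ^+ 3 - iota k * iota d); first by ring.
  rewrite ec' ed' ez'.
  transitivity (- (iota w * s0 ^+ 2 + iota p * s0 + iota u) * (iota w * s0 + 2%:R * iota p)).
    by ring3 h3'.
  by rewrite root oppr0 mul0r.
Qed.

Lemma line_quartic_sum : quartic_sum c a 1 d b = resolvent_sum c a 1 d b.
Proof.
apply: (quartic_sum_eq h3) line_quartic_nonsquare => [c0|s e].
  apply/eqP => a0; apply: (@line_quartic_no_double_root 1 0).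
  - by rewrite pair_neq0 oner_eq0.
  - by rewrite c0; ring.
  - by rewrite a0; ring.
rewrite mul1r; apply/eqP => e1; apply: (@line_quartic_no_double_root s 1).
- by rewrite pair_neq0 oner_eq0 orbT.
- by rewrite !expr1n !mulr1.
apply/eqP; rewrite -[X in _ == X]e; apply/eqP.
(* Euler's relation with 4 = 1: the quartic minus [s] times its first partial derivative is the
   second one at [t = 1]. *)
transitivity (quartic_value c a 1 d b s 1 - s * (c * s ^+ 3 - s + d));
  last by rewrite e1 mulr0 subr0.
by rewrite /quartic_value; ring3 h3.
Qed.

(* The points of the projective line; None is (1 : 0). *)
Definition proj_coord (o : option F) : F * F := if o is Some s then (s, 1) else (1, 0).

Lemma proj_coord_neq0 o : proj_coord o != (0, 0).
Proof. by case: o => [s|]; rewrite pair_neq0 oner_eq0 ?orbT. Qed.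

(** Points are indexed by cube roots of their outer coordinates, so that the discriminant becomes
    the cube of the quartic at the same [(s, t)]. *)
Definition line_vector (o : option F) : 'rV[F]_4 :=
  line_row x y ((proj_coord o).1 ^+ 3) ((proj_coord o).2 ^+ 3).

Lemma line_vector_neq0 o : line_vector o != 0.
Proof.
apply: line_row_neq0; rewrite pair_neq0 !expf_eq0 /= -pair_neq0 -surjective_pairing.
exact: proj_coord_neq0.
Qed.

Lemma line_vector_inj : injective (fun o => <<line_vector o>>%MS).
Proof.
move=> o o' /genmx_rowP[l e].
have e0 : (proj_coord o).1 ^+ 3 = l * (proj_coord o').1 ^+ 3.
  have := congr1 (fun v : 'rV_4 => v 0 0) e.
  by rewrite [RHS]mxE /line_vector !line_rowE.
have e3 : (proj_coord o).2 ^+ 3 = l * (proj_coord o').2 ^+ 3.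
  have := congr1 (fun v : 'rV_4 => v 0 3) e.
  by rewrite [RHS]mxE /line_vector !line_rowE.
case: o o' e0 e3 {e} => [s|] [s'|] //=; rewrite ?expr1n ?expr0n /= ?mulr0 ?mulr1.
- by move=> + e; rewrite -e mul1r => /(cube_inj h3) ->.
- by move=> _ /eqP; rewrite oner_eq0.
- by move=> + e; rewrite -e mul0r => /eqP; rewrite oner_eq0.
Qed.

Lemma line_points_codom : line_points L = [set <<line_vector o>>%MS | o : option F].
Proof.
apply/setP => P; rewrite inE; apply/andP/imsetP => [[/imsetP[w + ->]]|[o _ ->]].
  rewrite inE => w0; rewrite genmxE sub_line sub_line_row // => /eqP ew.
  have [w3|w3] := eqVneq (w 0 3) 0.
    have w00 : w 0 0 != 0.
      apply: contraNneq w0 => w00; rewrite ew w00 w3.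
      by have := line_row_scale x y 0 0 0; rewrite mulr0 scale0r => ->.
    exists None => //; rewrite ew w3 /line_vector /= expr1n expr0n /=.
    by rewrite -[in LHS](mulr1 (w 0 0)) -(mulr0 (w 0 0)) line_row_scale genmx_scale.
  have [s es] := cube_root h3 (w 0 0 / w 0 3).
  exists (Some s) => //; rewrite ew /line_vector /= -es expr1n.
  by rewrite -[LHS](genmx_scale _ (invr_neq0 w3)) -line_row_scale mulVf // mulrC.
rewrite mem_proj_points ?line_vector_neq0 //; split=> //.
by rewrite genmxE sub_line sub_line_row // !line_rowE.
Qed.

Lemma card_line_points_meet (X : {set 'M[F]_4}) :
  #|line_points L :&: X| = #|[set o | <<line_vector o>>%MS \in X]|.
Proof.
rewrite line_points_codom -(card_imset _ line_vector_inj); apply: eq_card => P.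
rewrite inE; apply/andP/imsetP => [[/imsetP[o _ ->] PX]|[o + ->]].
  by exists o; rewrite ?inE.
by rewrite inE => oX; split=> //; apply: imset_f.
Qed.

Definition point_value (o : option F) : F :=
  line_quartic (proj_coord o).1 (proj_coord o).2.

Lemma hess_disc_line_vector o : hess_disc (line_vector o) = point_value o ^+ 3.
Proof.
rewrite (hess_disc_cube h3 (s := (proj_coord o).1) (t := (proj_coord o).2)) ?line_rowE //.
by congr (_ ^+ 3); rewrite /point_value /line_quartic /quartic_value -/c -/a -/d -/b; ring.
Qed.

Lemma line_vector_not_cubic o : <<line_vector o>>%MS \notin twisted_cubic F.
Proof.
apply/negP => /twisted_cubicP[s [t [st0 e]]].
have : (nu s t <= x + y)%MS.
  rewrite -sub_line -(genmxE (nu s t)) -e -/(line_vector o).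
  have : <<line_vector o>>%MS \in line_points L by rewrite line_points_codom imset_f.
  by rewrite inE => /andP[].
rewrite nu_sub_line // => /andP[/eqP e1 /eqP e2].
apply: (line_quartic_no_double_root st0).
  by rewrite e2 -/c -/d; ring.
by rewrite e1 -/a -/b; ring.
Qed.

Lemma line_vector_not_axis o : <<line_vector o>>%MS \notin axis_points F.
Proof.
rewrite axis_pointsP ?line_vector_neq0 // !line_rowE !expf_eq0 /=.
by rewrite negb_and -pair_neq0 -surjective_pairing proj_coord_neq0.
Qed.

Lemma card_twisted_cubic_meet : #|line_points L :&: twisted_cubic F| = 0%N.
Proof.
rewrite card_line_points_meet; apply: eq_card0 => o.
by rewrite inE (negPf (line_vector_not_cubic o)).
Qed.

Lemma card_axis_meet : #|line_points L :&: axis_points F| = 0%N.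
Proof.
rewrite card_line_points_meet; apply: eq_card0 => o.
by rewrite inE (negPf (line_vector_not_axis o)).
Qed.

Lemma card_tangent_meet :
  #|line_points L :&: tangent_points F| = #|[set o | point_value o == 0]|.
Proof.
rewrite card_line_points_meet; apply: eq_card => o.
rewrite [LHS]inE [RHS]inE tangent_pointsP ?line_vector_neq0 ?line_vector_not_cubic
  ?line_vector_not_axis //.
by rewrite hess_disc_line_vector expf_eq0.
Qed.

Lemma card_real_chord_meet :
  #|line_points L :&: real_chord_points F| = #|[set o | chi (point_value o) == 1]|.
Proof.
rewrite card_line_points_meet; apply: eq_card => o.
by rewrite [LHS]inE [RHS]inE real_chord_pointsP ?line_vector_neq0 // hess_disc_line_vector chi_exp3.
Qed.

Lemma sum_point_value : \sum_o chi (point_value o) = quartic_sum c a 1 d b.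
Proof.
rewrite /quartic_sum (bigD1 None) //=; congr (_ + _).
  by congr chi; rewrite /point_value /line_quartic /quartic_value /=; ring.
rewrite (reindex_omap Some id) //=; last by case.
by apply: eq_bigl => s; rewrite eqxx.
Qed.

(** [quartic_Delta] is homogeneous of degree 6, so [1/r] is its value on the quartic normalized to
    middle coefficient 1. *)
Lemma card_E_line : (card_E (quartic_j z))%:Z = #|F|%:Z + 1 + quartic_sum c a 1 d b.
Proof.
rewrite line_quartic_sum; apply: card_E_resolvent_sum => //.
rewrite /quartic_j invf_div /quartic_Delta /c /a /b /d.
by field.
Qed.

Lemma card_values :
  (#|[set o | point_value o == 0%R]| + #|[set o | chi (point_value o) == 1%R]|
   + #|[set o | chi (point_value o) == (-1)%R]| = #|F|.+1)%N.
Proof.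
have E (Q : pred (option F)) : #|[set o | Q o]| = (\sum_o (if Q o then 1 else 0))%N.
  by rewrite -big_mkcond sum1_card cardsE.
rewrite -card_option -[RHS]sum1_card !E -!big_split /=.
apply: eq_bigr => o _; rewrite -chi_eq0.
by case/or3P: (chi_cases (point_value o)) => /eqP ->.
Qed.

Lemma sum_chi_card : \sum_o chi (point_value o) =
  #|[set o | chi (point_value o) == 1]|%:Z - #|[set o | chi (point_value o) == -1]|%:Z.
Proof.
have E v : #|[set o | chi (point_value o) == v]|%:Z =
    \sum_o (if chi (point_value o) == v then 1 else 0).
  by rewrite -big_mkcond sumr_const pmulrn intz cardsE.
rewrite !E -sumrB; apply: eq_bigr => o _.
by case/or3P: (chi_cases (point_value o)) => /eqP ->.
Qed.

(** Let [N0], [N1], [N2] count the zero, nonzero square and nonsquare values. Then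
    [N0 + N1 + N2 = q + 1] and [N1 - N2 = #E - (q + 1)]; adding gives [2 N1 = #E - N0]. *)
Lemma real_chord_count : #|[set o | chi (point_value o) == 1]|%:R =
  ((card_E (quartic_j z))%:R - #|[set o | point_value o == 0]|%:R) / 2 :> rat.
Proof.
have := card_E_line; rewrite -sum_point_value sum_chi_card.
have := congr1 (fun m => m%:R : rat) card_values; rewrite /= -addn1 !natrD => e.
move=> /(congr1 (fun i : int => i%:~R : rat)).
rewrite !rmorphD rmorphN /= -!pmulrn => ->.
have -> : #|F|%:R = #|[set o | point_value o == 0]|%:R +
  #|[set o | chi (point_value o) == 1]|%:R +
  #|[set o | chi (point_value o) == -1]|%:R - 1 :> rat by rewrite e addrK.
by field.
Qed.

Lemma imaginary_chord_count : #|[set o | chi (point_value o) == -1]|%:R =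
  #|F|%:R + 1 - ((card_E (quartic_j z))%:R + #|[set o | point_value o == 0]|%:R) / 2 :> rat.
Proof.
have := real_chord_count => /(congr1 (fun i => i * 2)); rewrite divfK // => e.
have -> : (card_E (quartic_j z))%:R = #|[set o | chi (point_value o) == 1]|%:R * 2 +
    #|[set o | point_value o == 0]|%:R :> rat by rewrite e subrK.
have := congr1 (fun m => m%:R : rat) card_values.
by rewrite -addn1 !natrD => <-; field.
Qed.

End GenericLine.

(** * Zeros of binary forms *)

Section BinaryForms.
Variable F : finFieldType.
Implicit Types (f g h l : {mpoly F[2]}) (s t : F).

Local Notation X := ('X_ord0 : {mpoly F[2]}).
Local Notation Y := ('X_ord_max : {mpoly F[2]}).

Definition binary_point s t : 'I_2 -> F := fun i => if i == ord0 then s else t.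

Lemma mevalXn v f k : (f ^+ k).@[v] = f.@[v] ^+ k.
Proof. exact: rmorphXn. Qed.

Lemma monomial_meval (c : F) (m k : nat) s t :
  (c *: (X ^+ m * Y ^+ k)).@[binary_point s t] = c * (s ^+ m * t ^+ k).
Proof. by rewrite mevalZ mevalM !mevalXn !mevalXU. Qed.

Lemma quartic_form_meval (z : 5.-tuple F) s t :
  (quartic_form z).@[binary_point s t] = quartic_value z`_0 z`_1 z`_2 z`_3 z`_4 s t.
Proof.
rewrite raddf_sum /= (eq_bigr _ (fun i _ => monomial_meval _ _ _ _ _)).
by rewrite !big_ord_recl big_ord0 /= /bump /= /quartic_value; ring.
Qed.

Lemma mderiv_exp (i : 'I_2) f k : (f ^+ k)^`M(i) = (f ^+ k.-1 * f^`M(i)) *+ k.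
Proof.
elim: k => [|[|k] IH]; first by rewrite expr0 mulr0n -mpolyC1 mderivC.
  by rewrite expr0 mul1r expr1.
rewrite exprS mderivM IH /= mulrnAr mulrA -exprS [f^`M(i) * _]mulrC.
by rewrite -mulrS.
Qed.

Lemma mderivXU (i k : 'I_2) : ('X_i : {mpoly F[2]})^`M(k) = (i == k)%:R.
Proof.
rewrite mderivX mnm1E; case: eqP => [->|_]; last by rewrite scale0r.
have -> : (U_(k) - U_(k) = 0)%MM by rewrite -{1}[U_(k)%MM]add0m addmK.
by rewrite scale1r mpolyX0.
Qed.

Lemma monomial_partials (c : F) (m k : nat) s t :
  ((c *: (X ^+ m * Y ^+ k))^`M(ord0)).@[binary_point s t]
     = c * ((s ^+ m.-1 * t ^+ k) *+ m) /\
  ((c *: (X ^+ m * Y ^+ k))^`M(ord_max)).@[binary_point s t]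
     = c * ((s ^+ m * t ^+ k.-1) *+ k).
Proof.
rewrite !mderivZ !mderivM !mderiv_exp !mderivXU /= !mevalZ !mevalD !mevalM !mevalMn.
rewrite !mevalM !mevalXn !mevalXU /= !(meval1, meval0) !(mulr0, mulr1, mul0rn, mul0r).
by rewrite addr0 add0r !(mulrnAl, mulrnAr).
Qed.

Lemma quartic_form_partials (h3 : 3%:R = 0 :> F) (z : 5.-tuple F) s t :
  ((quartic_form z)^`M(ord0)).@[binary_point s t]
     = z`_0 * s ^+ 3 - z`_2 * s * t ^+ 2 + z`_3 * t ^+ 3 /\
  ((quartic_form z)^`M(ord_max)).@[binary_point s t]
     = z`_1 * s ^+ 3 - z`_2 * s ^+ 2 * t + z`_4 * t ^+ 3.
Proof.
split.
  rewrite (raddf_sum (mderiv ord0)) raddf_sum /=.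
  rewrite (eq_bigr _ (fun i _ => (monomial_partials _ _ _ _ _).1)).
  transitivity (z`_0 * (s ^+ 3 * t ^+ 0 *+ 4) + (z`_1 * (s ^+ 2 * t ^+ 1 *+ 3) +
    (z`_2 * (s ^+ 1 * t ^+ 2 *+ 2) + (z`_3 * (s ^+ 0 * t ^+ 3 *+ 1) +
    (z`_4 * (s ^+ 0 * t ^+ 4 *+ 0) + 0))))); first by rewrite !big_ord_recl big_ord0.
  by ring3 h3.
rewrite (raddf_sum (mderiv ord_max)) raddf_sum /=.
rewrite (eq_bigr _ (fun i _ => (monomial_partials _ _ _ _ _).2)).
transitivity (z`_0 * (s ^+ 4 * t ^+ 0 *+ 0) + (z`_1 * (s ^+ 3 * t ^+ 0 *+ 1) +
  (z`_2 * (s ^+ 2 * t ^+ 1 *+ 2) + (z`_3 * (s ^+ 1 * t ^+ 2 *+ 3) +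
  (z`_4 * (s ^+ 0 * t ^+ 3 *+ 4) + 0))))); first by rewrite !big_ord_recl big_ord0.
by ring3 h3.
Qed.

Lemma common_zero_partial (v : 'I_2 -> F) (i : 'I_2) f g h : f.@[v] = 0 -> g.@[v] = 0 ->
  ((f * g * h)^`M(i)).@[v] = 0.
Proof.
move=> f0 g0; rewrite !mderivM !(mevalD, mevalM) f0 g0.
by rewrite !(mul0r, mulr0, addr0).
Qed.

Lemma ord2P (i : 'I_2) : i = ord0 \/ i = ord_max.
Proof. by case: i => [[|[|//]] hi]; [left | right]; apply: val_inj. Qed.

Lemma linear_formE l : l \is 1.-homog -> l = l@_U_(ord0) *: X + l@_U_(ord_max) *: Y.
Proof.
move=> hl; apply/mpolyP => m; rewrite mcoeffD !mcoeffZ !mcoeffX.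
have [/mdeg1P[i /eqP->]|m1] := boolP (mdeg m == 1%N).
  by rewrite !eq_mnm1; case: (ord2P i) => -> /=; rewrite !(mulr1, mulr0, addr0, add0r).
rewrite (dhomog_nemf_coeff hl) //.
have neq i : (U_(i) == m)%MM = false.
  by apply/negP => /eqP e; move: m1; rewrite -e mdeg1.
by rewrite !neq !mulr0 addr0.
Qed.

Definition form_value f (o : option F) : F :=
  f.@[binary_point (proj_coord o).1 (proj_coord o).2].

Lemma form_valueM f g o : form_value (f * g) o = form_value f o * form_value g o.
Proof. exact: mevalM. Qed.

Lemma linear_form_zero l : linear_form l ->
  exists o0, forall o, (form_value l o == 0) = (o == o0).
Proof.
case=> l0 /linear_formE el.
set al := l@__ in el; set be := l@__ in el.
have E o : form_value l o = al * (proj_coord o).1 + be * (proj_coord o).2.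
  by rewrite /form_value el mevalD !mevalZ !mevalXU.
have [a0|a0] := eqVneq al 0.
  have b0 : be != 0 by apply: contraNneq l0 => b0; rewrite el a0 b0 !scale0r addr0.
  exists None => -[s|]; rewrite E a0 /= mul0r add0r.
    by rewrite mulr1 (negPf b0).
  by rewrite mulr0 !eqxx.
exists (Some (- be / al)) => -[s|]; rewrite E /=; last first.
  by rewrite mulr1 mulr0 addr0 (negPf a0).
transitivity (s == - be / al) => //.
by rewrite mulr1 addr_eq0 -(inj_eq (mulfI a0) s) [al * (- be / al)]mulrC divfK.
Qed.

(* Reduction modulo the linear form vanishing at the point o. *)
Lemma form_factor d f o : f \is d.-homog -> form_value f o = 0 ->
  exists h l, [/\ l \is 1.-homog, form_value l o = 0 & f = h * l].
Proof.
move=> hf f0; pose s := (proj_coord o).1; pose t := (proj_coord o).2.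
(* Modulo [l] the variables become [s W] and [t W], where [W] is [Y] for an affine point and [X] for
   the point at infinity. *)
have [W [l [hl l0 [h0 e0] [h1 e1]]]] : exists W l : {mpoly F[2]},
    [/\ l \is 1.-homog, form_value l o = 0,
      exists h, X = s *: W + h * l & exists h, Y = t *: W + h * l].
  rewrite /s /t; case: o {f0 s t} => [r|] /=.
    exists Y, (X - r *: Y); split.
    - by rewrite dhomogD ?dhomogN ?dhomogZ // dhomogX /= mdeg1.
    - by rewrite /form_value mevalB mevalZ !mevalXU /= mulr1 subrr.
    - by exists 1; rewrite mul1r addrC subrK.
    - by exists 0; rewrite scale1r mul0r addr0.
  exists X, Y; split.
  - by rewrite dhomogX /= mdeg1.
  - by rewrite /form_value mevalXU.
  - by exists 0; rewrite scale1r mul0r addr0.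
  - by exists 1; rewrite scale0r add0r mul1r.
pose R (p p' : {mpoly F[2]}) := exists h, p = p' + h * l.
have Radd p p' r r' : R p p' -> R r r' -> R (p + r) (p' + r').
  by case=> h -> [k ->]; exists (h + k); ring.
have Rmul p p' r r' : R p p' -> R r r' -> R (p * r) (p' * r').
  by case=> h -> [k ->]; exists (p' * k + h * r' + h * k * l); ring.
have Rrefl p : R p p by exists 0; rewrite mul0r addr0.
have Rexp p p' k : R p p' -> R (p ^+ k) (p' ^+ k).
  by move=> Rp; elim: k => [|k IH]; rewrite ?expr0 ?exprS //; apply: Rmul.
(* A form of degree [d] is therefore congruent to [f(s, t) W^d]. *)
have [h eh] : R f (f.@[binary_point s t] *: W ^+ d).
  rewrite [f in R f _]mpolyE mevalE scaler_suml [in X in R X _]big_seq [in X in R _ X]big_seq.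
  apply: (big_ind2 R) => // m /(dhomog_mf hf) /= md.
  have -> : (f@_m * \prod_(i < 2) binary_point s t i ^+ m i) *: W ^+ d =
     f@_m *: \prod_(i < 2) (binary_point s t i *: W) ^+ m i.
    rewrite -scalerA; congr (_ *: _).
    rewrite -md mdegE -[W ^+ _]mul1r.
    rewrite !big_ord_recl !big_ord0 !exprZn /=.
    rewrite addn0 exprD !mulr1 mul1r.
    by rewrite -scalerAl -scalerAr scalerA.
  rewrite -!mul_mpolyC; apply: (Rmul _ _ _ _ (Rrefl _)).
  rewrite mpolyXE_id; apply: (big_ind2 R) => // i _; apply: Rexp.
  by case: (ord2P i) => ->; [exists h0 | exists h1].
exists h, l; split=> //.
by rewrite eh -/(form_value f o) f0 scale0r add0r.
Qed.

Lemma form_value_nonunit l o : form_value l o = 0 -> l \isn't a GRing.unit.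
Proof.
move=> l0; apply/negP => /mulrV /(congr1 (fun f => form_value f o)) /eqP.
by rewrite form_valueM l0 mul0r /form_value meval1 eq_sym oner_eq0.
Qed.

(** A zero would split off a linear factor; irreducibility makes the cofactor a constant, so the
    degree would be 1. *)
Lemma irreducible_form_nonzero d f o : (1 < d)%N -> irreducible_form d f ->
  form_value f o != 0.
Proof.
move=> d1 [f0 hf _ irr]; apply/eqP => fo.
have [h [l [hl lo ef]]] := form_factor hf fo.
case: (irr _ _ ef) => [/andP[/eqP eh _]|]; last by rewrite (negPf (form_value_nonunit lo)).
have hf1 : f \is 1.-homog by rewrite ef eh mul_mpolyC dhomogZ.
by move: d1; rewrite (dhomog_uniq f0 hf hf1).
Qed.

End BinaryForms.

(** * Number of zeros for each factorization type *)

Section ZeroCount.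
Variables (F : finFieldType) (Fbar : closedFieldType) (iota : {rmorphism F -> Fbar}).
Hypothesis h3 : 3%:R = 0 :> F.
Variables (L : 'M[F]_4) (x y : 'rV[F]_4).
Hypothesis hgen : generic_line iota L.
Hypothesis hLxy : (L == x + y)%MS.
Let z := quartic_of_line x y.
Let f := quartic_form z.
Let z2 : z`_2 != 0 := generic_line_axis h3 hgen hLxy.

Lemma point_value_eq0 o : (point_value x y o == 0) = (form_value f o == 0).
Proof.
have -> : form_value f o = z`_2 * point_value x y o.
  rewrite /form_value quartic_form_meval /point_value /line_quartic /quartic_value -/z.
  by field.
by rewrite mulf_eq0 (negPf z2).
Qed.

(** By the product rule, a common zero of two factors is a zero of both partial derivatives of [f],
    which genericity of [L] forbids. *)
Lemma no_common_zero (g h k : {mpoly F[2]}) o : f = g * h * k ->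
  form_value g o = 0 -> form_value h o != 0.
Proof.
move=> ef g0; apply/eqP => h0.
set s := (proj_coord o).1; set t := (proj_coord o).2.
have [e1 e2] := quartic_form_partials h3 z s t.
have := common_zero_partial ord0 k g0 h0; rewrite -ef e1 => {}e1.
have := common_zero_partial ord_max k g0 h0; rewrite -ef e2 => {}e2.
apply: (line_quartic_no_double_root h3 hgen hLxy (s := s) (t := t)).
- by rewrite /s /t -surjective_pairing proj_coord_neq0.
- by apply: (mulfI z2); rewrite mulr0 -[RHS]e1; field.
- by apply: (mulfI z2); rewrite mulr0 -[RHS]e2; field.
Qed.

Lemma factor_zeros_neq (g h k : {mpoly F[2]}) o1 o2 : f = g * h * k ->
  (forall o, (form_value g o == 0) = (o == o1)) ->
  (forall o, (form_value h o == 0) = (o == o2)) -> o1 != o2.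
Proof. by move=> ef eg eh; rewrite -eh (no_common_zero ef) //; apply/eqP; rewrite eg. Qed.

Lemma card_zeros (r : seq (option F)) : uniq r ->
  (forall o, (form_value f o == 0) = (o \in r)) ->
  #|[set o | point_value x y o == 0]| = size r.
Proof.
move=> /card_uniqP <- e; rewrite cardsE; apply: eq_card => o.
by rewrite -e -point_value_eq0.
Qed.

Lemma card_zeros_typeF1 : typeF1 f -> #|[set o | point_value x y o == 0]| = 1%N.
Proof.
case=> a [g [la ig ef]]; have [o1 za] := linear_form_zero la.
apply: (@card_zeros [:: o1]) => // o.
by rewrite ef form_valueM mulf_eq0 za (negPf (irreducible_form_nonzero _ _ ig)) // orbF inE.
Qed.

Lemma card_zeros_typeF2 : typeF2 f -> #|[set o | point_value x y o == 0]| = 2%N.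
Proof.
case=> a [b [g [la lb ig ef]]].
have [o1 za] := linear_form_zero la; have [o2 zb] := linear_form_zero lb.
apply: (@card_zeros [:: o1; o2]) => [|o].
  by rewrite /= inE andbT (factor_zeros_neq ef za zb).
rewrite ef !form_valueM !mulf_eq0 za zb (negPf (irreducible_form_nonzero _ _ ig)) //.
by rewrite orbF !inE.
Qed.

Lemma card_zeros_typeF4 : typeF4 f -> #|[set o | point_value x y o == 0]| = 4%N.
Proof.
case=> a [b [c [d [la lb lc ld ef]]]].
have [o1 za] := linear_form_zero la; have [o2 zb] := linear_form_zero lb.
have [o3 zc] := linear_form_zero lc; have [o4 zd] := linear_form_zero ld.
apply: (@card_zeros [:: o1; o2; o3; o4]) => [|o]; last first.
  by rewrite ef !form_valueM !mulf_eq0 za zb zc zd !inE !orbA.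
have n12 : o1 != o2 by apply: (@factor_zeros_neq a b (c * d)); rewrite // ef; ring.
have n13 : o1 != o3 by apply: (@factor_zeros_neq a c (b * d)); rewrite // ef; ring.
have n14 : o1 != o4 by apply: (@factor_zeros_neq a d (b * c)); rewrite // ef; ring.
have n23 : o2 != o3 by apply: (@factor_zeros_neq b c (a * d)); rewrite // ef; ring.
have n24 : o2 != o4 by apply: (@factor_zeros_neq b d (a * c)); rewrite // ef; ring.
have n34 : o3 != o4 by apply: (@factor_zeros_neq c d (a * b)); rewrite // ef; ring.
by rewrite /= !inE !negb_or n12 n13 n14 n23 n24 n34.
Qed.

Lemma card_zeros_no_linear_factor :
  typeF2' f \/ typeF4' f -> #|[set o | point_value x y o == 0]| = 0%N.
Proof.
move=> hf; apply: (@card_zeros [::]) => // o; apply/negbTE.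
case: hf => [hf|[g [h [ig ih ef]]]]; first exact: irreducible_form_nonzero hf.
rewrite ef form_valueM mulf_neq0 //; exact: (@irreducible_form_nonzero _ 2).
Qed.

End ZeroCount.


(** * Intersection numbers for all factorization types *)

Theorem theorem1p8
  (q n : nat) (hn : (0 < n)%N) (hq : q = (3 ^ n)%N)
  (F : finFieldType) (hF : #|F| = q)
  (F2 : finFieldType) (hF2 : #|F2| = (q ^ 2)%N) (j : {rmorphism F -> F2})
  (Fbar : closedFieldType) (iota : {rmorphism F -> Fbar})
  (hFbar : integralRange iota)
  (L : 'M[F]_4) (hL : is_line L) (hgen : generic_line iota L)
  (x y : 'rV[F]_4) (hx : x != 0) (hy : y != 0) (hxy : ~~ (x == y)%MS)
  (hLxy : (L == x + y)%MS) :
  let P := line_points L in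
  let z := quartic_of_line x y in
  let f := quartic_form z in
  let r := quartic_j z in
  (forall i : nat,
     [\/ i = 1%N /\ typeF1 f, i = 2%N /\ typeF2 f | i = 4%N /\ typeF4 f] ->
     [/\ #|P :&: twisted_cubic F| = 0%N,
         #|P :&: axis_points F| = 0%N,
         #|P :&: tangent_points F| = i,
         #|P :&: real_chord_points F|%:R = ((card_E r)%:R - i%:R) / 2 :> rat
       & #|P :&: imaginary_chord_points j|%:R
           = q%:R + 1 - ((card_E r)%:R + i%:R) / 2 :> rat])
  /\
  (typeF2' f \/ typeF4' f ->
     [/\ #|P :&: twisted_cubic F| = 0%N,
         #|P :&: axis_points F| = 0%N,
         #|P :&: tangent_points F| = 0%N,
         #|P :&: real_chord_points F|%:R = (card_E r)%:R / 2 :> rat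
       & #|P :&: imaginary_chord_points j|%:R
           = q%:R + 1 - (card_E r)%:R / 2 :> rat]).

Proof.
have hF3 : #|F| = (3 ^ n)%N by rewrite hF.
have hF2' : #|F2| = (#|F| ^ 2)%N by rewrite hF.
have h3 := char3_card hF3.
move=> P z f r.
have cC : #|P :&: twisted_cubic F| = 0%N := card_twisted_cubic_meet h3 hgen hLxy.
have cA : #|P :&: axis_points F| = 0%N := card_axis_meet h3 hgen hLxy.
have cT := card_tangent_meet h3 hgen hLxy.
have cR := real_chord_count h3 hgen hLxy.
have cI := imaginary_chord_count h3 hgen hLxy.
have cRm := card_real_chord_meet h3 hgen hLxy.
have cIm : #|P :&: imaginary_chord_points j| = #|[set o | chi (point_value x y o) == -1]|.
  rewrite (card_line_points_meet h3 hgen hLxy); apply: eq_card => o.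
  rewrite [LHS]inE [RHS]inE (imaginary_chord_pointsP j hF3 hF2').
    by rewrite (hess_disc_line_vector h3) chi_exp3.
  exact: line_vector_neq0.
rewrite -/P -cRm in cR; rewrite -/P -cIm hF in cI.
split=> [i hi | hf].
  have ci : #|[set o | point_value x y o == 0]| = i.
    case: hi => -[-> hf]; [exact: (card_zeros_typeF1 h3 hgen hLxy hf)
      | exact: (card_zeros_typeF2 h3 hgen hLxy hf) | exact: (card_zeros_typeF4 h3 hgen hLxy hf)].
  by split=> //; rewrite ?cT // -ci.
have c0 := card_zeros_no_linear_factor h3 hgen hLxy hf.
by rewrite c0 subr0 in cR; rewrite c0 addr0 in cI; split=> //; rewrite cT.
Qed.
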